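(* Let $\mathbf W$ be a general channel with finite input alphabet $\mathcal X$ and arbitrary output alphabet $\mathcal Y$, let $\mathbf c$ be a general cost function and $\Gamma\in\mathbb R$, and suppose $\mathbf W$ satisfies the strong converse property with input cost constraint $\Gamma$. Then for all $\varepsilon,\delta,\mu,\lambda\ge0$ with $\varepsilon<1$, $\mu+\lambda<1$, $\delta<1$, $$\sup_{\mathbf X\in\mathcal S_\Gamma}\underline I(\mathbf X;\mathbf Y)=C_s(\varepsilon,\Gamma|\mathbf W)=D(\mu,\lambda,\Gamma|\mathbf W)=S(\delta,\Gamma|\mathbf W)=\sup_{\mathbf X\in\mathcal S_\Gamma}\overline I(\mathbf X;\mathbf Y).$$
   Context: A general channel $\mathbf W=\{W^n\}$ with input alphabet $\mathcal X$ and output alphabet $\mathcal Y$ is a sequence of transition probabilities $W^n(\cdot|\mathbf x)$ on $\mathcal Y^n$, $\mathbf x\in\mathcal X^n$. A general cost function is a sequence of functions $c_n:\mathcal X^n\to\mathbb R$; $\mathcal X^n(\Gamma)=\{\mathbf x:\frac1n c_n(\mathbf x)\le\Gamma\}$. $\mathcal S_\Gamma$ is the set of input processes $\mathbf X=\{X^n\}$ with $\Pr\{X^n\in\mathcal X^n(\Gamma)\}=1$ for all $n$; $\mathbf Y=\{Y^n\}$, $Y^n$ the output of $W^n$ for input $X^n$. For real random variables $Z_n$: $\text{p-}\liminf Z_n=\sup\{\alpha:\lim_n\Pr\{Z_n<\alpha\}=0\}$, $\text{p-}\limsup Z_n=\inf\{\beta:\lim_n\Pr\{Z_n>\beta\}=0\}$.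 $\underline I(\mathbf X;\mathbf Y)$ (resp. $\overline I$) is the p-liminf (resp. p-limsup) of $\frac1n\log\frac{W^n(Y^n|X^n)}{P_{Y^n}(Y^n)}$ (for abstract $\mathcal Y$ the ratio is the Radon–Nikodym derivative $\frac{dP_{X^nY^n}}{d(P_{X^n}\times P_{Y^n})}$). $QW^n(B)=\sum_{\mathbf x}Q(\mathbf x)W^n(B|\mathbf x)$. Transmission codes: an $(n,M_n,\varepsilon_n,\Gamma)$ code is an encoder $\varphi_n:\{1,\dots,M_n\}\to\mathcal X^n$ with $\frac1nc_n(\varphi_n(i))\le\Gamma$ for all $i$, and a decoder $\psi_n:\mathcal Y^n\to\{1,\dots,M_n\}$, with $\varepsilon_n=\frac1{M_n}\sum_iW^n(\mathcal D_i^c|\varphi_n(i))$, $\mathcal D_i=\psi_n^{-1}(i)$. $R$ is $(\varepsilon,\Gamma)$-achievable if such codes exist with $\limsup\varepsilon_n\le\varepsilon$, $\liminf\frac1n\log M_n\ge R$; $C_s(\varepsilon,\Gamma|\mathbf W)$ is the supremum of such $R$, and $C_s(\Gamma|\mathbf W)=C_s(0,\Gamma|\mathbf W)$. The strong converse property with input cost constraint $\Gamma$: every sequence of such codes with $\liminf\frac1n\log M_n>C_s(\Gamma|\mathbf W)$ has $\varepsilon_n\to1$. Identification codes: an $(n,N_n,\mu_n,\lambda_n,\Gamma)$ code consists of distributions $Q_1,\dots,Q_{N_n}$ on $\mathcal X^n$ with $Q_i(\mathcal X^n(\Gamma))=1$ and (not necessarily disjoint) sets $\mathcal D_1,\dots,\mathcal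 D_{N_n}\subset\mathcal Y^n$, with $\mu_n=\max_iQ_iW^n(\mathcal D_i^c)$, $\lambda_n=\max_{i\ne j}Q_jW^n(\mathcal D_i)$. $R$ is $(\mu,\lambda,\Gamma)$-achievable if such codes exist with $\limsup\mu_n\le\mu$, $\limsup\lambda_n\le\lambda$, $\liminf\frac1n\log\log N_n\ge R$; $D(\mu,\lambda,\Gamma|\mathbf W)$ is the supremum of such $R$. Resolvability: $d(P,P')=2\sup_B|P(B)-P'(B)|$; $U_M$ uniform on $\{1,\dots,M\}$. For $\mathbf X\in\mathcal S_\Gamma$, $R$ is $(\delta,\Gamma)$-achievable for $\mathbf X$ if there are $M_n$ and maps $\varphi_n:\{1,\dots,M_n\}\to\mathcal X^n(\Gamma)$ such that, with $\tilde Y^n$ the output of $W^n$ for input $\varphi_n(U_{M_n})$, $\limsup d(P_{Y^n},P_{\tilde Y^n})\le\delta$ and $\limsup\frac1n\log M_n\le R$. $R$ is $(\delta,\Gamma)$-achievable if so for all $\mathbf X\in\mathcal S_\Gamma$; $S(\delta,\Gamma|\mathbf W)$ is the infimum of such $R$. *)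

(* Defs.v *)
From HB Require Import structures.
From mathcomp Require Import all_boot all_order all_algebra.
From mathcomp Require Import all_classical all_reals all_analysis.
Set Implicit Arguments.
Unset Strict Implicit.
Unset Printing Implicit Defensive.
Import Order.TTheory GRing.Theory Num.Theory.
Import numFieldNormedType.Exports.
Local Open Scope classical_set_scope.
Local Open Scope ring_scope.

Record pmf (R : realType) (T : finType) := Pmf {
  pmf_val :> T -> R ;
  pmf_ge0 : forall t, 0 <= pmf_val t ;
  pmf_sum1 : \sum_t pmf_val t = 1 }.

Section outm.
Local Open Scope ereal_scope.
Context (R : realType) (X : finType) d (Y : measurableType d)
  (Q : pmf R X) (W : X -> probability Y R).

Definition outm (B : set Y) : \bar R := \sum_(x : X) (Q x)%:E * W x B.

Let outm0 : outm set0 = 0.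
Proof. by rewrite /outm big1// => x _; rewrite measure0 mule0. Qed.

Let outm_ge0 B : 0 <= outm B.
Proof. by apply: sume_ge0 => x _; rewrite mule_ge0// lee_fin pmf_ge0. Qed.

Let outm_sigma_additive : semi_sigma_additive outm.
Proof.
move=> F mF tF mUF; rewrite [X in _ --> X](_ : _ =
    lim ((fun n => \sum_(0 <= i < n) outm (F i)) @ \oo)).
  by apply: is_cvg_ereal_nneg_natsum => k _; exact: outm_ge0.
rewrite nneseries_sum//; last first.
  by move=> x j _; rewrite mule_ge0// lee_fin pmf_ge0.
apply: eq_bigr => /= x _.
by rewrite nneseriesZl// measure_semi_bigcup.
Qed.

HB.instance Definition _ := isMeasure.Build _ _ _ outm
  outm0 outm_ge0 outm_sigma_additive.

Let outm_setT : outm setT = 1.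
Proof.
rewrite /outm (eq_bigr (fun x => (Q x)%:E)); last first.
  by move=> x _; rewrite probability_setT mule1.
by rewrite sumEFin pmf_sum1.
Qed.

HB.instance Definition _ := Measure_isProbability.Build _ _ _ outm outm_setT.

End outm.

Section defs.
Context (R : realType) (X : finType) d (Y : measurableType d)
  (W : forall n : nat, n.-tuple X -> probability (n.-tuple Y) R)
  (c : forall n : nat, n.-tuple X -> R) (Gamma : R).

(* X^n(Gamma) = {x : c_n(x)/n <= Gamma}; no constraint at the meaningless
   block length n = 0. *)
Definition cost_ok (n : nat) (x : n.-tuple X) : Prop :=
  (0 < n)%N -> c x / n%:R <= Gamma.

Definition out_dist n (Q : pmf R (n.-tuple X)) := outm Q (@W n).

Definition QW n (Q : pmf R (n.-tuple X)) (B : set (n.-tuple Y)) : R :=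
  \sum_x Q x * fine (W x B).

Definition dens n (Q : pmf R (n.-tuple X)) (x : n.-tuple X) : n.-tuple Y -> \bar R :=
  Radon_Nikodym (charge_of_finite_measure (W x)) (out_dist Q).

Definition info_dens n (Q : pmf R (n.-tuple X)) (x : n.-tuple X) (y : n.-tuple Y) : R :=
  ln (fine (dens Q x y)) / n%:R.

Definition pr_info_lt n (Q : pmf R (n.-tuple X)) (a : R) : R :=
  \sum_x Q x * fine (W x [set y | info_dens Q x y < a]).
Definition pr_info_gt n (Q : pmf R (n.-tuple X)) (b : R) : R :=
  \sum_x Q x * fine (W x [set y | info_dens Q x y > b]).

Definition input_process := forall n : nat, pmf R (n.-tuple X).

Definition in_S (Qs : input_process) : Prop :=
  forall n, \sum_(x | `[< cost_ok x >]) Qs n x = 1.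

Definition I_low (Qs : input_process) : \bar R :=
  ereal_sup [set a%:E | a in [set a : R | (pr_info_lt (Qs n) a) @[n --> \oo] --> (0 : R)]].
Definition I_up (Qs : input_process) : \bar R :=
  ereal_inf [set b%:E | b in [set b : R | (pr_info_gt (Qs n) b) @[n --> \oo] --> (0 : R)]].

Definition sup_I_low : \bar R := ereal_sup [set I_low Qs | Qs in in_S].
Definition sup_I_up : \bar R := ereal_sup [set I_up Qs | Qs in in_S].

Definition trans_code (M : nat -> nat)
    (phi : forall n, 'I_(M n) -> n.-tuple X)
    (psi : forall n, n.-tuple Y -> 'I_(M n)) : Prop :=
  forall n, [/\ (0 < M n)%N, (forall i, cost_ok (phi n i)) &
                (forall i, measurable (psi n @^-1` [set i]))].

Definition trans_err (M : nat -> nat)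
    (phi : forall n, 'I_(M n) -> n.-tuple X)
    (psi : forall n, n.-tuple Y -> 'I_(M n)) (n : nat) : R :=
  (M n)%:R^-1 * \sum_(i < M n) fine (W (phi n i) (~` (psi n @^-1` [set i]))).

Definition rate (M : nat -> nat) (n : nat) : \bar R := (ln (M n)%:R / n%:R)%:E.

Definition trans_achievable (eps : R) (r : R) : Prop :=
  exists M phi psi, [/\ @trans_code M phi psi,
     (limn_esup (fun n => (trans_err phi psi n)%:E) <= eps%:E)%E &
     (r%:E <= limn_einf (rate M))%E].

Definition Cs (eps : R) : \bar R := ereal_sup [set r%:E | r in trans_achievable eps].

Definition strong_converse : Prop :=
  forall M phi psi, @trans_code M phi psi ->
    (Cs 0 < limn_einf (rate M))%E ->
    (trans_err phi psi n) @[n --> \oo] --> (1 : R).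

Definition id_code (N : nat -> nat)
    (Qi : forall n, 'I_(N n) -> pmf R (n.-tuple X))
    (D : forall n, 'I_(N n) -> set (n.-tuple Y)) : Prop :=
  forall n, [/\ (0 < N n)%N,
    (forall i, \sum_(x | `[< cost_ok x >]) Qi n i x = 1) &
    (forall i, measurable (D n i))].

Definition id_mu (N : nat -> nat) (Qi : forall n, 'I_(N n) -> pmf R (n.-tuple X))
    (D : forall n, 'I_(N n) -> set (n.-tuple Y)) (n : nat) : R :=
  \big[Num.max/0]_(i < N n) QW (Qi n i) (~` D n i).

Definition id_lambda (N : nat -> nat) (Qi : forall n, 'I_(N n) -> pmf R (n.-tuple X))
    (D : forall n, 'I_(N n) -> set (n.-tuple Y)) (n : nat) : R :=
  \big[Num.max/0]_(i < N n) \big[Num.max/0]_(j < N n | j != i) QW (Qi n j) (D n i).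

Definition id_rate (N : nat -> nat) (n : nat) : \bar R :=
  (ln (ln (N n)%:R) / n%:R)%:E.

Definition id_achievable (mu lambda : R) (r : R) : Prop :=
  exists N Qi D, [/\ @id_code N Qi D,
     (limn_esup (fun n => (id_mu Qi D n)%:E) <= mu%:E)%E,
     (limn_esup (fun n => (id_lambda Qi D n)%:E) <= lambda%:E)%E &
     (r%:E <= limn_einf (id_rate N))%E].

Definition Did (mu lambda : R) : \bar R :=
  ereal_sup [set r%:E | r in id_achievable mu lambda].

(* variational distance d(P_{Y^n}, P_{~Y^n}) where ~Y^n is the output for
   input phi(U_M) *)
Definition var_dist n (Q : pmf R (n.-tuple X)) (M : nat) (phi : 'I_M -> n.-tuple X) : \bar R :=
  (2%:E * ereal_sup [set (`| QW Q B - (M%:R^-1 * \sum_(i < M) fine (W (phi i) B)) |)%:E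
                    | B in [set B : set (n.-tuple Y) | measurable B]])%E.

Definition resolv_achievable_for (delta : R) (Qs : input_process) (r : R) : Prop :=
  exists (M : nat -> nat) (phi : forall n, 'I_(M n) -> n.-tuple X),
    [/\ forall n, (0 < M n)%N,
        forall n i, cost_ok (phi n i),
        (limn_esup (fun n => var_dist (Qs n) (phi n)) <= delta%:E)%E &
        (limn_esup (rate M) <= r%:E)%E].

Definition resolv_achievable (delta : R) (r : R) : Prop :=
  forall Qs, in_S Qs -> resolv_achievable_for delta Qs r.

Definition Sres (delta : R) : \bar R :=
  ereal_inf [set r%:E | r in resolv_achievable delta].

End defs.

(* Main.v *)
(** The quantities form a closed circle of inequalities.  Write A and B for the
    suprema of the lower and upper information rates.  Clearly A <= B.  If B
    exceeded C_s(0), Feinstein's lemma would give codes of rate above C_s(0)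
    whose error does not tend to 1, against the strong converse; and C_s(0) <= A
    is the Verdu-Han converse, applied to the uniform input on the codebook.
    Hence A = B = C_s(0) = C_s(eps).  A Feinstein codebook also yields an
    identification code of doubly exponential size, so A <= D(0,0).
    Approximating the inputs of an identification code by uniform inputs on few
    codewords leaves fewer types than messages, so D(mu,lambda) <= S(delta) as
    soon as mu + lambda + delta < 1.  Finally S(0) <= B is soft covering.  It
    remains to use D(0,0) <= D(mu,lambda) <= S(0) and D(0,0) <= S(delta) <= S(0). *)
Require Import Defs.
From mathcomp Require Import all_boot all_order all_algebra.
From mathcomp Require Import all_classical all_reals all_analysis.
From mathcomp Require Import measurable_realfun ring lra.
Set Implicit Arguments.
Unset Strict Implicit.
Unset Printing Implicit Defensive.
Import Order.TTheory GRing.Theory Num.Theory.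
Import numFieldNormedType.Exports.
Local Open Scope classical_set_scope.
Local Open Scope ring_scope.

(* [probability] also has a [pmf], of a discrete random variable. *)
Local Notation pmf := Defs.pmf.
Local Notation pmf_ge0 := Defs.pmf_ge0.
Local Notation pmf_sum1 := Defs.pmf_sum1.

Lemma greedy_seq (T : Type) (x0 : T) (good : seq T -> T -> Prop) M :
  (forall s, (size s < M)%N ->
     (forall i, (i < size s)%N -> good (take i s) (nth x0 s i)) -> exists x, good s x) ->
  exists2 s, size s = M & forall i, (i < M)%N -> good (take i s) (nth x0 s i).
Proof.
elim: M => [_|M IH H]; first by exists [::].
have [s sM Hs] := IH (fun s sM => H s (ltnW sM)).
have [x gx] : exists x, good s x by apply: H; rewrite sM.
exists (rcons s x); first by rewrite size_rcons sM.
move=> i; rewrite ltnS leq_eqVlt => /predU1P[->|iM].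
  by rewrite -sM nth_rcons ltnn eqxx -cats1 take_size_cat.
by rewrite nth_rcons sM iM -cats1 take_cat sM iM; exact: Hs.
Qed.

Section real_valued_probability.
Context (R : realType) d (Y : measurableType d) (P : probability Y R).

Let pfin B : measurable B -> P B \is a fin_num := fun mB => fin_num_measure P B mB.

Lemma prob_ge0 B : 0 <= fine (P B).
Proof. exact/fine_ge0. Qed.

Lemma prob_le (A B : set Y) : measurable A -> measurable B -> A `<=` B ->
  fine (P A) <= fine (P B).
Proof. by move=> mA mB AB; apply: fine_le; rewrite ?pfin// le_measure ?inE. Qed.

Lemma prob_setT : fine (P setT) = 1.
Proof. by rewrite probability_setT. Qed.

Lemma prob_le1 B : measurable B -> fine (P B) <= 1.
Proof. by move=> mB; rewrite -prob_setT; apply: prob_le. Qed.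

Lemma prob_split (A B : set Y) : measurable A -> measurable B ->
  fine (P A) = fine (P (A `&` B)) + fine (P (A `\` B)).
Proof.
move=> mA mB; rewrite -fineD ?pfin//; [|exact: measurableI|exact: measurableD].
by rewrite addeC -measureDI.
Qed.

Lemma prob_setC B : measurable B -> fine (P (~` B)) = 1 - fine (P B).
Proof.
move=> mB; have := prob_split measurableT mB.
by rewrite prob_setT setTI setTD => ->; rewrite addrC addKr.
Qed.

Lemma prob_setU_le (A B : set Y) : measurable A -> measurable B ->
  fine (P (A `|` B)) <= fine (P A) + fine (P B).
Proof.
move=> mA mB; rewrite (prob_split (measurableU _ _ mA mB) mA).
by apply: lerD; apply: prob_le => //;
  [apply: measurableI => //; exact: measurableU|apply: measurableD => //; exact: measurableU|
   move=> y [] []].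
Qed.

Lemma prob_cover_le (A B C : set Y) :
  measurable A -> measurable B -> measurable C -> C `<=` A `|` B ->
  fine (P C) <= fine (P A) + fine (P B).
Proof.
move=> mA mB mC CAB; apply: le_trans (prob_setU_le mA mB).
by apply: prob_le => //; exact: measurableU.
Qed.

Lemma prob_bigcup_le (I : Type) (r : seq I) (F : I -> set Y) :
  (forall i, measurable (F i)) ->
  fine (P (\big[setU/set0]_(i <- r) F i)) <= \sum_(i <- r) fine (P (F i)).
Proof.
move=> mF; elim: r => [|i r IH]; first by rewrite !big_nil measure0.
rewrite !big_cons; apply: (le_trans (prob_setU_le _ _)) => //.
  exact: bigsetU_measurable.
by rewrite lerD2l.
Qed.

Lemma prob_sum_disjoint_le1 (I : finType) (F : I -> set Y) :
  (forall i, measurable (F i)) ->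
  (forall i j, i != j -> F i `&` F j = set0) ->
  \sum_i fine (P (F i)) <= 1.
Proof.
move=> mF dF; pose K (s : seq I) := \big[setU/set0]_(i <- s) F i.
have mK s : measurable (K s) by apply: bigsetU_measurable.
suff H (s : seq I) : uniq s -> \sum_(i <- s) fine (P (F i)) = fine (P (K s)).
  by rewrite H ?index_enum_uniq//; exact: prob_le1.
elim: s => [_|i s IH /= /andP[iNs us]]; first by rewrite /K !big_nil measure0.
rewrite big_cons IH// /K big_cons -/(K s).
have dis : F i `&` K s = set0.
  rewrite /K big_distrr/= big_seq big1// => j js; apply: dF.
  by apply: contraNneq iNs => ->.
by rewrite measureU//= fineD ?pfin.
Qed.

End real_valued_probability.

Section output_density.
Context (R : realType) (T : finType) d (Y : measurableType d)
  (Q : pmf R T) (W : T -> probability Y R).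

Lemma pmf_gt0_neq0 x : (0 < Q x) = (Q x != 0).
Proof. by rewrite lt0r pmf_ge0 andbT. Qed.

Lemma outmE B : measurable B -> fine (outm Q W B) = \sum_x Q x * fine (W x B).
Proof.
move=> mB; rewrite /outm -[RHS]/(fine (_)%:E) -sumEFin; congr fine.
by apply: eq_bigr => x _; rewrite EFinM fineK// fin_num_measure.
Qed.

Lemma outm_dominates x : 0 < Q x -> charge_of_finite_measure (W x) `<< outm Q W.
Proof.
move=> Qx; apply/null_content_dominatesP => A mA /= PA0.
have: fine (outm Q W A) = 0 by rewrite PA0.
rewrite outmE// => /eqP; rewrite psumr_eq0; last first.
  by move=> y _; rewrite mulr_ge0 ?pmf_ge0 ?prob_ge0.
move=> /allP /(_ x (mem_index_enum _)) /implyP /(_ isT).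
rewrite mulf_eq0 gt_eqF//= => /eqP WA.
by rewrite -[LHS]fineK ?fin_num_measure// WA.
Qed.

Definition rnd x : Y -> R := fun y =>
  fine (Radon_Nikodym (charge_of_finite_measure (W x)) (outm Q W) y).

Lemma rnd_integrable x : 0 < Q x ->
  (outm Q W).-integrable setT (EFin \o rnd x).
Proof.
move=> Qx; have := Radon_Nikodym_integrable (outm_dominates Qx).
apply: eq_integrable => //.
by move=> y _; rewrite /rnd /= fineK// Radon_Nikodym_fin_num//; exact: outm_dominates.
Qed.

Lemma measurable_rnd x : 0 < Q x -> measurable_fun setT (rnd x).
Proof.
by move=> Qx; have /measurable_int /measurable_EFinP := rnd_integrable Qx.
Qed.

Lemma rnd_int x B : 0 < Q x -> measurable B ->
  W x B = (\int[outm Q W]_(y in B) (rnd x y)%:E)%E.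
Proof.
move=> Qx mB.
rewrite -[LHS]/(charge_of_finite_measure (W x) B).
rewrite (Radon_Nikodym_integral (outm_dominates Qx) mB).
apply: eq_integral => y _; rewrite /rnd fineK// Radon_Nikodym_fin_num//.
exact: outm_dominates.
Qed.

Lemma rnd_upper x B t : 0 < Q x -> measurable B -> (forall y, B y -> rnd x y <= t) ->
  fine (W x B) <= t * fine (outm Q W B).
Proof.
move=> Qx mB Bt; rewrite -lee_fin EFinM !fineK ?fin_num_measure// (rnd_int Qx mB).
rewrite -integral_cst//; apply: le_integral => //.
- by apply: integrableS (rnd_integrable Qx).
- by apply: finite_measure_integrable_cst.
- by move=> y; rewrite inE => By; rewrite lee_fin Bt.
Qed.

Lemma rnd_lower x B t : 0 < Q x -> measurable B -> (forall y, B y -> t <= rnd x y) ->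
  t * fine (outm Q W B) <= fine (W x B).
Proof.
move=> Qx mB Bt; rewrite -lee_fin EFinM !fineK ?fin_num_measure// (rnd_int Qx mB).
rewrite -integral_cst//; apply: le_integral => //.
- by apply: finite_measure_integrable_cst.
- by apply: integrableS (rnd_integrable Qx).
- by move=> y; rewrite inE => By; rewrite lee_fin Bt.
Qed.

Lemma measurable_rnd_gt x t : 0 < Q x -> measurable [set y | t < rnd x y].
Proof.
move=> Qx; have := measurable_rnd Qx measurableT (measurable_itv `]t, +oo[).
rewrite setTI; congr measurable; apply/seteqP; split => y /=; rewrite in_itv/= andbT//.
Qed.

Lemma measurable_rnd_le x t : 0 < Q x -> measurable [set y | rnd x y <= t].
Proof.
move=> Qx; have := measurable_rnd Qx measurableT (measurable_itv `]-oo, t]).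
by rewrite setTI; congr measurable; apply/seteqP; split => y /=; rewrite in_itv/=.
Qed.

Lemma measurable_rnd_lt x t : 0 < Q x -> measurable [set y | rnd x y < t].
Proof.
move=> Qx; have := measurable_rnd Qx measurableT (measurable_itv `]-oo, t[).
by rewrite setTI; congr measurable; apply/seteqP; split => y /=; rewrite in_itv/=.
Qed.

Lemma rnd_le0_null x : 0 < Q x -> fine (W x [set y | rnd x y <= 0]) = 0.
Proof.
move=> Qx; apply/eqP; rewrite eq_le prob_ge0 andbT.
have := rnd_upper Qx (measurable_rnd_le 0 Qx) (fun _ h => h).
by rewrite mul0r.
Qed.

Lemma outm_rnd_gt x t : 0 < Q x -> 0 < t ->
  fine (outm Q W [set y | t < rnd x y]) <= t^-1.
Proof.
move=> Qx t0; rewrite -[leRHS]mul1r ler_pdivlMr// mulrC.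
apply: le_trans (prob_le1 (W x) (measurable_rnd_gt t Qx)).
by apply: rnd_lower => //; [exact: measurable_rnd_gt|move=> y /ltW].
Qed.

Lemma pmf_avg_le (F G : T -> R) : (forall x, 0 < Q x -> F x <= G x) ->
  \sum_x Q x * F x <= \sum_x Q x * G x.
Proof.
move=> FG; apply: ler_sum => x _; have := pmf_ge0 Q x.
by rewrite le_eqVlt => /predU1P[<-|Qx]; rewrite ?mul0r// ler_pM2l// FG.
Qed.

Lemma pmf_avg_cst (a : R) : \sum_x Q x * a = a.
Proof. by rewrite -mulr_suml pmf_sum1 mul1r. Qed.

Lemma exists_le_avg (F : T -> R) e : \sum_x Q x * F x <= e ->
  exists2 x, 0 < Q x & F x <= e.
Proof.
move=> Fe; have [x Qx] : exists x, 0 < Q x.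
  apply/not_existsP => Q0; have := pmf_sum1 Q; rewrite big1 => [/esym/eqP|x _].
    by rewrite oner_eq0.
  by apply/eqP; have /negP := Q0 x; rewrite pmf_gt0_neq0 negbK.
apply: contrapT => /forall2NP H.
have {}H z : 0 < Q z -> e < F z.
  by move=> Qz; case: (H z) => [//|/negP]; rewrite -ltNge.
have ge0 z : 0 <= Q z * (F z - e).
  have := pmf_ge0 Q z; rewrite le_eqVlt => /predU1P[<-|Qz]; first by rewrite mul0r.
  by rewrite mulr_ge0 ?pmf_ge0// subr_ge0 ltW ?H.
have : \sum_z Q z * (F z - e) == 0.
  rewrite eq_le sumr_ge0// andbT.
  under eq_bigr do rewrite mulrBr.
  by rewrite sumrB pmf_avg_cst subr_le0.
rewrite psumr_eq0// => /allP /(_ x (mem_index_enum _)) /=.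
by rewrite mulf_eq0 gt_eqF//= subr_eq0 gt_eqF// H.
Qed.
Definition typical t x := [set y | 0 < Q x /\ t < rnd x y].

Lemma measurable_typical t x : measurable (typical t x).
Proof.
rewrite /typical; case: (boolP (0 < Q x)) => [Qx|_].
  rewrite (_ : [set y | _] = [set y | t < rnd x y]); first exact: measurable_rnd_gt.
  by apply/seteqP; split=> [y []|y].
by rewrite (_ : [set y | _] = set0)//; apply/seteqP; split=> [y []|y].
Qed.

Lemma outm_typical_le t x : 0 < t -> fine (outm Q W (typical t x)) <= t^-1.
Proof.
move=> t0; case: (boolP (0 < Q x)) => [Qx|Qx].
  apply: le_trans (outm_rnd_gt Qx t0).
  apply: prob_le; [exact: measurable_typical|exact: measurable_rnd_gt|by move=> y []].
rewrite (_ : typical t x = set0) ?measure0 ?invr_ge0 ?ltW//.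
by apply/seteqP; split=> [y []|y]//; rewrite (negbTE Qx).
Qed.

Lemma setC_typical t x : 0 < Q x -> ~` typical t x = [set y | rnd x y <= t].
Proof.
move=> Qx; apply/seteqP; split => y /=.
  by move=> /not_andP[//|/negP]; rewrite -leNgt.
by rewrite leNgt => /negP yt [].
Qed.

(* Codewords are picked one by one, each averaging out the part of its typical
   set already claimed by its predecessors. *)
Lemma feinstein t e M : 0 < t ->
  \sum_x Q x * fine (W x [set y | rnd x y <= t]) + M%:R / t <= e ->
  exists (u : 'I_M -> T) (D : 'I_M -> set Y),
    [/\ forall i, 0 < Q (u i), forall i, measurable (D i),
        forall i j, i != j -> D i `&` D j = set0 &
        forall i, fine (W (u i) (~` D i)) <= e].
Proof.
move=> t0 He; have [x0 Qx0 _] : exists2 x, 0 < Q x & 0 <= 0 :> R.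
  by apply: (@exists_le_avg (fun=> 0)); rewrite pmf_avg_cst.
pose U (s : seq T) := \big[setU/set0]_(x <- s) typical t x.
have mU s : measurable (U s).
  by apply: bigsetU_measurable => i _; exact: measurable_typical.
pose good s x := 0 < Q x /\ fine (W x (~` (typical t x `\` U s))) <= e.
have [s sM Hs] : exists2 s, size s = M &
    forall i, (i < M)%N -> good (take i s) (nth x0 s i).
  apply: greedy_seq => s sM _.
  have [x Qx xe] : exists2 x, 0 < Q x & fine (W x (~` (typical t x `\` U s))) <= e.
    apply: exists_le_avg; apply: le_trans He.
    have mUs : fine (outm Q W (U s)) <= M%:R / t.
      apply: (le_trans (prob_bigcup_le _ _ _)); first by move=> x; exact: measurable_typical.
      apply: (@le_trans _ _ (\sum_(x <- s) t^-1)).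
        by apply: ler_sum => x _; exact: outm_typical_le.
      rewrite big_const_seq count_predT iter_addr addr0 -[leLHS]mulr_natl.
      by rewrite ler_wpM2r ?invr_ge0 ?(ltW t0)// ler_nat ltnW.
    apply: le_trans (lerD (lexx _) mUs).
    rewrite outmE// -big_split/=; under [leRHS]eq_bigr do rewrite -mulrDr.
    apply: pmf_avg_le => x Qx; rewrite -setC_typical//.
    apply: prob_cover_le => //.
    - by apply: measurableC; exact: measurable_typical.
    - by apply: measurableC; apply: measurableD => //; exact: measurable_typical.
    - by rewrite setDE setCI setCK.
  by exists x.
exists (fun i => nth x0 s i), (fun i => typical t (nth x0 s i) `\` U (take i s)).
split.
- by move=> i; have [] := Hs i (ltn_ord i).
- by move=> i; apply: measurableD => //; exact: measurable_typical.
- suff H i j : (i < j < M)%N -> (typical t (nth x0 s i) `\` U (take i s)) `&`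
      (typical t (nth x0 s j) `\` U (take j s)) = set0.
    move=> i j; rewrite -(inj_eq val_inj) neq_ltn => /orP[] ij.
      by apply: H; rewrite ij ltn_ord.
    by rewrite setIC; apply: H; rewrite ij ltn_ord.
  move=> /andP[ij jM]; apply/seteqP; split=> // y [[Ti _] [_]]; case.
  rewrite /U -bigcup_seq; exists (nth x0 s i) => //=.
  rewrite -(nth_take x0 ij); apply: mem_nth; rewrite size_takel// sM; exact: ltnW.
- by move=> i; have [] := Hs i (ltn_ord i).
Qed.

End output_density.

Section decoder.
Context d (Y : measurableType d).

Lemma disjoint_decoder M (D : 'I_M -> set Y) : (0 < M)%N ->
  (forall i, measurable (D i)) -> (forall i j, i != j -> D i `&` D j = set0) ->
  exists psi : Y -> 'I_M, forall i,
    measurable (psi @^-1` [set i]) /\ D i `<=` psi @^-1` [set i].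
Proof.
case: M D => // M D _ mD dD.
pose psi y := odflt ord0 [pick i | `[< D i y >]].
have DE i y : D i y -> psi y = i.
  move=> Diy; rewrite /psi; case: pickP => [j /asboolP Djy|/(_ i)/asboolP//] /=.
  apply/eqP; apply: contrapT => /negP ji.
  by have : (D j `&` D i) y by []; rewrite dD.
have psiE y : D (psi y) y \/ (psi y = ord0 /\ forall i, ~ D i y).
  rewrite /psi; case: pickP => [j /asboolP Djy|H] /=; [by left|right].
  by split=> // i; have /asboolP := H i.
exists psi => i; split; last by move=> y /DE.
have [->|i0] := eqVneq i ord0; last first.
  rewrite (_ : _ @^-1` _ = D i)//; apply/seteqP; split=> [y /= yi|y /DE //].
  by have := psiE y; rewrite yi => -[//|[p0]]; rewrite p0 eqxx in i0.
rewrite (_ : _ @^-1` _ = ~` \big[setU/set0]_(j <- enum 'I_M.+1 | j != ord0) D j).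
  by apply: measurableC; apply: bigsetU_measurable.
rewrite -bigcup_seq_cond; apply/seteqP; split=> y /=.
  move=> y0 [j /= /andP[_ j0] Djy].
  by move: j0; rewrite -(DE _ _ Djy) y0 eqxx.
move=> H; case: (psiE y) => [Dy|[]//].
apply/eqP; apply: contrapT => /negP p0; apply: H; exists (psi y) => //=.
by rewrite mem_enum p0.
Qed.

End decoder.

Section uniform.
Context (R : realType) (T : finType) (M : nat) (phi : 'I_M -> T) (M0 : (0 < M)%N).

Let unif_val x : R := M%:R^-1 * \sum_(i < M) (phi i == x)%:R.

Let unif_avg (F : T -> R) :
  \sum_x unif_val x * F x = M%:R^-1 * \sum_(i < M) F (phi i).
Proof.
under eq_bigr do rewrite /unif_val -mulrA mulr_suml.
rewrite -mulr_sumr exchange_big/=; congr (_ * _); apply: eq_bigr => i _.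
rewrite (bigD1 (phi i))//= eqxx mul1r big1 ?addr0// => x xi.
by rewrite eq_sym (negbTE xi) mul0r.
Qed.

Let unif_ge0 x : 0 <= unif_val x.
Proof. by rewrite mulr_ge0 ?invr_ge0// sumr_ge0. Qed.

Let unif_sum1 : \sum_x unif_val x = 1.
Proof.
have := unif_avg (fun=> 1); under eq_bigr do rewrite mulr1.
by move=> ->; rewrite sumr_const card_ord mulVf// pnatr_eq0 -lt0n.
Qed.

Definition unif_pmf : pmf R T := Pmf unif_ge0 unif_sum1.

Lemma unif_pmf_avg (F : T -> R) :
  \sum_x unif_pmf x * F x = M%:R^-1 * \sum_(i < M) F (phi i).
Proof. exact: unif_avg. Qed.

Lemma unif_pmf_gt0 i : 0 < unif_pmf (phi i).
Proof.
rewrite /= /unif_val mulr_gt0 ?invr_gt0 ?ltr0n// (bigD1 i)//= eqxx.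
by rewrite ltr_pwDl// sumr_ge0.
Qed.

End uniform.

Section verdu_han.
Context (R : realType) (T : finType) d (Y : measurableType d)
  (W : T -> probability Y R).

Lemma verdu_han M (phi : 'I_M -> T) (psi : Y -> 'I_M) (M0 : (0 < M)%N) t : 0 <= t ->
  (forall i, measurable (psi @^-1` [set i])) ->
  \sum_x unif_pmf R phi M0 x *
      fine (W x [set y | rnd (unif_pmf R phi M0) W x y < t]) <=
  M%:R^-1 * \sum_(i < M) fine (W (phi i) (~` (psi @^-1` [set i]))) + t / M%:R.
Proof.
move=> t0 mpsi; set Q := unif_pmf R phi M0; rewrite unif_pmf_avg [t / _]mulrC -mulrDr.
rewrite ler_wpM2l ?invr_ge0//.
have Dle : \sum_i fine (outm Q W (psi @^-1` [set i])) <= 1.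
  apply: prob_sum_disjoint_le1 => // i j ij; apply/seteqP; split=> // y [/= -> ji].
  by rewrite ji eqxx in ij.
rewrite -[t in leRHS]mulr1; apply: le_trans (lerD (lexx _) (ler_wpM2l t0 Dle)).
rewrite mulr_sumr -big_split/=; apply: ler_sum => i _.
have Qi : 0 < Q (phi i) by exact: unif_pmf_gt0.
set A := [set y | _]; set D := psi @^-1` _.
have mA : measurable A by exact: measurable_rnd_lt.
have mD : measurable D by exact: mpsi.
have mAD : measurable (D `&` A) by exact: measurableI.
apply: (@le_trans _ _ (fine (W (phi i) (~` D)) + fine (W (phi i) (D `&` A)))).
  apply: prob_cover_le => //; first exact: measurableC.
  by move=> y Ay; have [Dy|] := pselect (D y); [right|left].
rewrite lerD2l; apply: (le_trans (rnd_upper (t := t) Qi mAD _)).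
  by move=> y [_ /ltW].
rewrite ler_wpM2l//; apply: prob_le => //; exact: subIsetl.
Qed.

End verdu_han.
Section bounded_functions.
Context (R : realType) d (Y : measurableType d) (P : probability Y R).

Definition bdd (f : Y -> R) := measurable_fun setT f /\ exists K, forall y, `|f y| <= K.

Lemma bdd_cst a : bdd (fun=> a).
Proof. by split => //; exists `|a|. Qed.

Lemma bddD f g : bdd f -> bdd g -> bdd (fun y => f y + g y).
Proof.
move=> [mf [K Kf]] [mg [L Lg]]; split; first exact: measurable_funD.
by exists (K + L) => y; apply: (le_trans (ler_normD _ _)); exact: lerD.
Qed.

Lemma bddM f g : bdd f -> bdd g -> bdd (fun y => f y * g y).
Proof.
move=> [mf [K Kf]] [mg [L Lg]]; split; first exact: measurable_funM.
by exists (K * L) => y; rewrite normrM; exact: ler_pM.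
Qed.

Lemma bddZ a f : bdd f -> bdd (fun y => a * f y).
Proof. by apply: bddM; exact: bdd_cst. Qed.

Lemma bddB f g : bdd f -> bdd g -> bdd (fun y => f y - g y).
Proof.
move=> bf bg; have := bddD bf (bddZ (-1) bg).
by congr bdd; apply/funext => y; rewrite mulN1r.
Qed.

Lemma bdd_sum (I : Type) (r : seq I) (F : I -> Y -> R) :
  (forall i, bdd (F i)) -> bdd (fun y => \sum_(i <- r) F i y).
Proof.
move=> bF; elim: r => [|i r IH].
  by under eq_fun do rewrite big_nil; exact: bdd_cst.
by under eq_fun do rewrite big_cons; exact: bddD.
Qed.

Lemma bdd_indic B : measurable B -> bdd (\1_B : Y -> R).
Proof.
move=> mB; split; first exact: measurable_indic.
by exists 1 => y; rewrite indicE; case: (_ \in _); rewrite ?normr1 ?normr0.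
Qed.

Lemma bdd_integrable f : bdd f -> P.-integrable setT (EFin \o f).
Proof.
move=> [mf [K Kf]]; apply: measurable_bounded_integrable => //.
  by rewrite (le_lt_trans (probability_le1 P measurableT))// ltry.
exists K; split; first exact: num_real.
by move=> L KL y _; apply: (le_trans (Kf y)); exact: ltW.
Qed.

Definition mean (f : Y -> R) : R := \int[P]_y f y.

Lemma meanD f g : bdd f -> bdd g -> mean (fun y => f y + g y) = mean f + mean g.
Proof. by move=> bf bg; rewrite /mean RintegralD//; exact: bdd_integrable. Qed.

Lemma meanZ a f : bdd f -> mean (fun y => a * f y) = a * mean f.
Proof. by move=> bf; rewrite /mean RintegralZl//; exact: bdd_integrable. Qed.

Lemma mean_cst a : mean (fun=> a) = a.
Proof. by rewrite /mean Rintegral_cst// [X in a * X](_ : _ = 1) ?mulr1//; exact: prob_setT. Qed.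

Lemma mean_sum (I : Type) (r : seq I) (F : I -> Y -> R) : (forall i, bdd (F i)) ->
  mean (fun y => \sum_(i <- r) F i y) = \sum_(i <- r) mean (F i).
Proof.
move=> bF; elim: r => [|i r IH].
  by under eq_fun do rewrite big_nil; rewrite mean_cst big_nil.
by under eq_fun do rewrite big_cons; rewrite meanD ?IH ?big_cons//; exact: bdd_sum.
Qed.

Lemma mean_le f g : bdd f -> bdd g -> (forall y, f y <= g y) -> mean f <= mean g.
Proof.
by move=> bf bg fg; rewrite /mean; apply: le_Rintegral => //; exact: bdd_integrable.
Qed.

End bounded_functions.

Section soft_covering.
Context (R : realType) (T : finType) d (Y : measurableType d)
  (Q : pmf R T) (W : T -> probability Y R) (t : R).
Hypothesis t_ge0 : 0 <= t.

Let mu := outm Q W.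
Let E := mean mu.

Let A x := [set y | 0 < Q x /\ 0 < rnd Q W x y <= t].

Let h x y := rnd Q W x y * \1_(A x) y.

Let mA x : measurable (A x).
Proof.
case: (boolP (0 < Q x)) => [Qx|Qx].
  rewrite (_ : A x = [set y | 0 < rnd Q W x y] `&` [set y | rnd Q W x y <= t]).
    by apply: measurableI; [exact: measurable_rnd_gt|exact: measurable_rnd_le].
  by apply/seteqP; split=> [y [_ /andP[]]|y [/= y1 y2]]//=; split=> //; apply/andP.
by rewrite (_ : A x = set0)//; apply/seteqP; split=> [y []|]//; rewrite (negbTE Qx).
Qed.

Let h_itv x y : 0 <= h x y <= t.
Proof.
rewrite /h indicE; case: (boolP (y \in A x)) => [|_].
  by rewrite inE mulr1 => -[_ /andP[/ltW -> ->]].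
by rewrite mulr0 lexx.
Qed.

Let bh x : bdd (h x).
Proof.
split; last by exists t => y; have /andP[h0 ht] := h_itv x y; rewrite ger0_norm.
case: (boolP (0 < Q x)) => [Qx|Qx].
  by apply: measurable_funM; [exact: measurable_rnd|exact: measurable_indic].
rewrite (_ : h x = fun=> 0)//; apply/funext => y; rewrite /h indicE.
by case: (boolP (y \in A x)) => [|_]; [rewrite inE => -[]; rewrite (negbTE Qx)|rewrite mulr0].
Qed.

Let Eh x B : 0 < Q x -> measurable B ->
  E (fun y => h x y * \1_B y) = fine (W x (B `&` [set y | rnd Q W x y <= t])).
Proof.
move=> Qx mB.
have mL := measurable_rnd_le W t Qx; have m0 := measurable_rnd_le W 0 Qx.
have mBA : measurable (B `&` A x) by exact: measurableI.
have -> : fine (W x (B `&` [set y | rnd Q W x y <= t])) = fine (W x (B `&` A x)).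
  apply/eqP; rewrite eq_le; apply/andP; split; last first.
    apply: prob_le => //; first exact: measurableI.
    by move=> y [By [_ /andP[_ ?]]].
  rewrite -[leRHS]addr0 -(rnd_le0_null W Qx); apply: prob_cover_le => //.
    exact: measurableI.
  move=> y [By /= yt]; case: (leP (rnd Q W x y) 0) => y0; first by right.
  by left; split => //; split=> //; apply/andP.
rewrite (rnd_int W Qx mBA) /E /mean /Rintegral integral_mkcond; congr fine.
rewrite [RHS]integral_mkcond.
apply: eq_integral => y _; rewrite /= !patchE.
rewrite in_setI in_setT /h !indicE.
by case: (y \in B); case: (y \in A x); rewrite /= ?mulr1 ?mulr0.
Qed.

Let hb y := \sum_x Q x * h x y.

Let bhb : bdd hb. Proof. by apply: bdd_sum => x; exact: bddZ. Qed.

Let S s y := \sum_(x <- s) (h x y - hb y).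

Let bS s : bdd (S s). Proof. by apply: bdd_sum => x; exact: bddB. Qed.

Let V s := E (fun y => S s y * S s y).

Let V_step s : \sum_x Q x * V (rcons s x) <= V s + t.
Proof.
have bSS u : bdd (fun y => S u y * S u y) by exact: bddM.
have -> : \sum_x Q x * V (rcons s x) =
    E (fun y => \sum_x Q x * (S (rcons s x) y * S (rcons s x) y)).
  rewrite /E mean_sum; last by move=> x; exact: bddZ.
  by apply: eq_bigr => x _; rewrite meanZ.
have Ehb : E hb <= 1.
  rewrite /E mean_sum; last by move=> x; exact: bddZ.
  rewrite -(pmf_avg_cst Q 1); under eq_bigr do rewrite meanZ//.
  apply: pmf_avg_le => x Qx.
  have := Eh Qx measurableT; under eq_fun do rewrite indicT mulr1.
  by rewrite /E => ->; apply: prob_le1; rewrite setTI; exact: measurable_rnd_le.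
apply: (@le_trans _ _ (E (fun y => S s y * S s y + t * hb y))); last first.
  rewrite /E meanD ?meanZ//; last exact: bddZ.
  by rewrite lerD2l -[leRHS]mulr1 ler_wpM2l.
apply: mean_le; [by apply: bdd_sum => x; exact: bddZ|by apply: bddD => //; exact: bddZ|].
move=> y.
have SE x : S (rcons s x) y = S s y + (h x y - hb y).
  by rewrite /S -cats1 big_cat/= big_seq1.
have -> : \sum_x Q x * (S (rcons s x) y * S (rcons s x) y) =
   S s y * S s y - hb y * hb y + \sum_x Q x * (h x y * h x y).
  rewrite (eq_bigr (fun x =>
     Q x * ((S s y - hb y) * (S s y - hb y)) + (2 * (S s y - hb y)) * (Q x * h x y)
     + Q x * (h x y * h x y))); last by move=> x _; rewrite SE; ring.
  by rewrite !big_split/= pmf_avg_cst -mulr_sumr -/(hb y); ring.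
rewrite -[hb y in leRHS]/(\sum_x Q x * h x y) mulr_sumr.
apply: (@le_trans _ _ (S s y * S s y + \sum_x Q x * (h x y * h x y))).
  by rewrite lerD2r gerBl -expr2 sqr_ge0.
rewrite lerD2l; apply: ler_sum => x _; rewrite [leRHS]mulrCA ler_wpM2l ?pmf_ge0//.
by have /andP[h0 ht] := h_itv x y; rewrite ler_wpM2r.
Qed.

Let tail x := fine (W x [set y | t < rnd Q W x y]).

Let W_split x B : 0 < Q x -> measurable B ->
  fine (W x B) = E (fun y => h x y * \1_B y) + fine (W x (B `&` [set y | t < rnd Q W x y])).
Proof.
move=> Qx mB; rewrite Eh// (prob_split (W x) mB (measurable_rnd_le W t Qx)).
congr (_ + fine (W x _)).
by apply/seteqP; split => y /= [By]; rewrite ltNge => /negP.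
Qed.

(* Derandomized random coding: the codewords are picked one by one so that a
   weighted sum of the second moment of the truncated density and of the tail
   never exceeds its conditional expectation. *)
Lemma soft_covering M c : (0 < M)%N -> 0 < c -> exists u : 'I_M -> T,
  (forall i, 0 < Q (u i)) /\ forall B, measurable B ->
    `|fine (mu B) - M%:R^-1 * \sum_(i < M) fine (W (u i) B)| <=
    c / 2 + t / (2 * c * M%:R) + 2 * \sum_x Q x * tail x.
Proof.
move=> M0 c0; have M0R : 0 < M%:R :> R by rewrite ltr0n.
have [x0 Qx0 _] : exists2 x, 0 < Q x & 0 <= 0 :> R.
  by apply: (@exists_le_avg _ _ _ (fun=> 0)); rewrite pmf_avg_cst.
pose al := (2 * c * M%:R ^+ 2)^-1.
have al0 : 0 <= al by rewrite invr_ge0 !mulr_ge0// ltW.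
pose Tl := \sum_x Q x * tail x.
pose Phi s := al * V s + M%:R^-1 * \sum_(x <- s) tail x.
pose inc := al * t + M%:R^-1 * Tl.
pose good s x := 0 < Q x /\ Phi (rcons s x) <= Phi s + inc.
have [s sM Hs] : exists2 s, size s = M &
    forall i, (i < M)%N -> good (take i s) (nth x0 s i).
  apply: greedy_seq => s sM _.
  have [x Qx xe] : exists2 x, 0 < Q x & Phi (rcons s x) <= Phi s + inc.
    apply: exists_le_avg.
    have -> : \sum_x Q x * Phi (rcons s x) =
        al * (\sum_x Q x * V (rcons s x)) + M%:R^-1 * (\sum_(x <- s) tail x + Tl).
      rewrite (eq_bigr (fun x => al * (Q x * V (rcons s x)) +
          (M%:R^-1 * (Q x * (\sum_(x <- s) tail x)) + M%:R^-1 * (Q x * tail x)))); last first.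
        by move=> x _; rewrite /Phi -cats1 big_cat/= big_seq1 cats1; ring.
      by rewrite !big_split/= -!mulr_sumr pmf_avg_cst -/Tl; ring.
    rewrite /Phi /inc !mulrDr addrACA lerD2r -mulrDr.
    by rewrite ler_wpM2l ?V_step.
  by exists x.
have Phis k : (k <= M)%N -> Phi (take k s) <= k%:R * inc.
  elim: k => [_|k IH kM].
    by rewrite take0 /Phi /V /S; under eq_fun do rewrite !big_nil mulr0;
      rewrite /E mean_cst big_nil !mulr0 addr0 mul0r.
  rewrite (take_nth x0) ?sM//; have [_ /le_trans->//] := Hs _ kM.
  by rewrite -natr1 mulrDl mul1r lerD2r; apply: IH; exact: ltnW.
have {}Phis : Phi s <= t / (2 * c * M%:R) + Tl.
  have := Phis M (leqnn _); rewrite -sM take_size => /le_trans; apply; rewrite sM.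
  rewrite /inc mulrDr mulrA [_ * (_ * Tl)]mulrA mulfV ?gt_eqF// mul1r lerD2r.
  by rewrite /al le_eqVlt; apply/orP; left; apply/eqP; field; rewrite !gt_eqF.
pose u (i : 'I_M) := nth x0 s i.
have Qu i : 0 < Q (u i) by have [] := Hs i (ltn_ord i).
exists u; split=> // B mB.
have sum_u (F : T -> R) : \sum_(i < M) F (u i) = \sum_(x <- s) F x.
  by rewrite [RHS](big_nth x0) sM big_mkord.
have bhB x : bdd (fun y => h x y * \1_B y) by apply: bddM => //; exact: bdd_indic.
pose b x := fine (W x (B `&` [set y | t < rnd Q W x y])).
have b_itv x : 0 < Q x -> 0 <= b x <= tail x.
  move=> Qx; rewrite prob_ge0/=; apply: prob_le; [|exact: measurable_rnd_gt|exact: subIsetr].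
  by apply: measurableI => //; exact: measurable_rnd_gt.
have -> : fine (mu B) = E (fun y => hb y * \1_B y) + \sum_x Q x * b x.
  rewrite outmE//.
  have -> : (fun y => hb y * \1_B y) = (fun y => \sum_x Q x * (h x y * \1_B y)).
    by apply/funext => y; rewrite /hb mulr_suml; apply: eq_bigr => x _; rewrite mulrA.
  rewrite /E mean_sum; last by move=> x; exact: bddZ.
  rewrite -big_split/=; apply: eq_bigr => x _; rewrite meanZ// -mulrDr.
  have := pmf_ge0 Q x; rewrite le_eqVlt => /predU1P[<-|Qx]; first by rewrite !mul0r.
  by rewrite [in LHS]W_split.
have -> : \sum_(i < M) fine (W (u i) B) =
    E (fun y => (S s y + M%:R * hb y) * \1_B y) + \sum_(i < M) b (u i).
  under eq_bigr do rewrite W_split//.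
  rewrite big_split/=; congr (_ + _); rewrite (sum_u (fun x => E (fun y => h x y * \1_B y))).
  rewrite -mean_sum//; congr mean; apply/funext => y; rewrite -mulr_suml; congr (_ * _).
  rewrite /S sumrB big_const_seq count_predT iter_addr addr0 sM mulr_natl.
  by rewrite subrK.
set b1 := \sum_x Q x * b x; set b2 := \sum_(i < M) b (u i).
have b1_itv : 0 <= b1 <= Tl.
  apply/andP; split.
    by apply: sumr_ge0 => x _; rewrite mulr_ge0 ?pmf_ge0// prob_ge0.
  by apply: pmf_avg_le => x /b_itv/andP[].
have b2_itv : 0 <= M%:R^-1 * b2 <= M%:R^-1 * \sum_(x <- s) tail x.
  rewrite -sum_u; apply/andP; split.
    by rewrite mulr_ge0 ?invr_ge0// sumr_ge0// => i _; rewrite prob_ge0.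
  by rewrite ler_wpM2l ?invr_ge0//; apply: ler_sum => i _; have /andP[] := b_itv _ (Qu i).
have bI : bdd (\1_B : Y -> R) by exact: bdd_indic.
have bSB : bdd (fun y => S s y * \1_B y) by exact: bddM.
have bhbB : bdd (fun y => hb y * \1_B y) by exact: bddM.
have -> : E (fun y => (S s y + M%:R * hb y) * \1_B y) =
    E (fun y => S s y * \1_B y) + M%:R * E (fun y => hb y * \1_B y).
  rewrite /E -meanZ// -meanD//; last exact: bddZ.
  by congr mean; apply/funext => y; rewrite mulrDl mulrA.
set e := E (fun y => S s y * \1_B y); set f := E (fun y => hb y * \1_B y).
have -> : f + b1 - M%:R^-1 * (e + M%:R * f + b2) = b1 - M%:R^-1 * b2 - M%:R^-1 * e.
  by field; rewrite gt_eqF.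
have e_le : `|M%:R^-1 * e| <= c / 2 + al * V s.
  have K (sg : R) : `|sg| = 1 -> sg * (M%:R^-1 * e) <= c / 2 + al * V s.
    move=> sg1; have bSS : bdd (fun y => S s y * S s y) by exact: bddM.
    rewrite mulrA /e /V -meanZ// -meanZ// -[c / 2](mean_cst mu) -meanD//; last first.
    - exact: bddZ.
    - exact: bdd_cst.
    apply: mean_le; [exact: bddZ|by apply: bddD; [exact: bdd_cst|exact: bddZ]|].
    move=> y; set v := S s y / M%:R.
    (* AM-GM: [v <= c / 2 + v^2 / (2 c)] *)
    apply: (@le_trans _ _ `|v|).
      apply: (le_trans (ler_norm _)); rewrite !normrM sg1 mul1r mulrA.
      rewrite [`|_^-1| * _]mulrC -normrM -/v ler_piMr//.
      by rewrite indicE; case: (_ \in _); rewrite ?normr1 ?normr0.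
    have -> : al * (S s y * S s y) = `|v| ^+ 2 / (2 * c).
      rewrite real_normK ?num_real// /al /v; field; rewrite !gt_eqF//.
    rewrite -subr_ge0 (_ : _ - _ = (`|v| - c) ^+ 2 / (2 * c)); last first.
      by field; rewrite gt_eqF.
    by rewrite divr_ge0 ?sqr_ge0// mulr_ge0// ltW.
  rewrite ler_norml; apply/andP; split.
    by rewrite lerNl -mulN1r; apply: K; rewrite normrN1.
  by rewrite -[leLHS]mul1r; apply: K; rewrite normr1.
have {e_le} := e_le; move: Phis; rewrite /Phi ler_norml => Phis /andP[e1 e2].
move: b1_itv b2_itv => /andP[b10 b11] /andP[b20 b21].
rewrite ler_norml -/Tl; apply/andP; split; lra.
Qed.

End soft_covering.
Section words.
Context (m q : nat).
Implicit Types f g : {ffun 'I_m -> 'I_q}.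

Definition agree f g := #|[pred j | f j == g j]|.

Lemma agreeC f g : agree f g = agree g f.
Proof. by apply: eq_card => j; rewrite !inE eq_sym. Qed.

Lemma sum_exp_agree f : (\sum_g q ^ agree f g <= (2 * q) ^ m)%N.
Proof.
pose F (j : 'I_m) (a : 'I_q) := (if f j == a then q else 1)%N.
have -> : (\sum_g q ^ agree f g =
    \sum_(g : {ffun 'I_m -> 'I_q}) \prod_j F j (g j))%N.
  apply: eq_bigr => g _; rewrite /F -big_mkcond/= big_const iter_muln_1.
  by congr (_ ^ _)%N; apply: eq_card => j.
rewrite -(bigA_distr_bigA F) -[m in leqRHS]card_ord -prod_nat_const.
apply: leq_prod => j _; rewrite mul2n -addnn (bigD1 (f j))//= /F eqxx leq_add2l.
rewrite (eq_bigr (fun=> 1%N)); last by move=> a; rewrite eq_sym => /negbTE ->.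
by rewrite sum1_card (leq_trans (max_card _))// card_ord.
Qed.

End words.

(* The weight [q ^ agree f g] makes words that agree with [f] in a fraction
   [1 / k] of the positions so heavy, for [q = 4 ^ k], that [2 ^ m] words cannot
   exclude all of them. *)
Lemma separated_words k m : (0 < k)%N ->
  exists w : 'I_(2 ^ m) -> {ffun 'I_m -> 'I_(4 ^ k)},
    forall i j, i != j -> (agree (w i) (w j) * k < m)%N.
Proof.
move=> k0; set q := (4 ^ k)%N; have q0 : (0 < q)%N by rewrite expn_gt0.
pose far (f g : {ffun 'I_m -> 'I_q}) := (agree f g * k < m)%N.
pose w0 : {ffun 'I_m -> 'I_q} := [ffun=> Ordinal q0].
have [s sM Hs] : exists2 s : seq {ffun 'I_m -> 'I_q}, size s = (2 ^ m)%N &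
    forall i, (i < 2 ^ m)%N -> all (far^~ (nth w0 s i)) (take i s).
  apply: (@greedy_seq _ w0 (fun s g => is_true (all (far^~ g) s)) (2 ^ m)) => s sM _.
  apply/existsP; apply: contraTT sM => /existsPn Hs; rewrite -leqNgt.
  have bad f : (#|[pred g | ~~ far f g]| * 2 ^ m <= q ^ m)%N.
    rewrite -(@leq_pmul2r (2 ^ m)) ?expn_gt0// -mulnA -expnMn.
    rewrite -expnMn [(q * 2)%N]mulnC; apply: leq_trans (sum_exp_agree f).
    rewrite -sum_nat_const [leqRHS](bigID [pred g | ~~ far f g])/=.
    apply: leq_trans (leq_addr _ _); apply: leq_sum => g.
    by rewrite inE /far -leqNgt => mk; rewrite -expnM mulnC leq_exp2l// mulnC.
  have : (q ^ m <= \sum_(f <- s) #|[pred g | ~~ far f g]|)%N.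
    have -> : (q ^ m = \sum_(g : {ffun 'I_m -> 'I_q}) 1)%N.
      by rewrite sum1_card card_ffun !card_ord.
    under [leqRHS]eq_bigr do rewrite -sum1_card big_mkcond/=.
    rewrite exchange_big/=; apply: leq_sum => g _.
    have /allPn[f fs nf] := Hs g.
    by rewrite (big_rem f)//= inE nf.
  rewrite -(@leq_pmul2r (2 ^ m)) ?expn_gt0// big_distrl/= => /leq_trans H.
  rewrite -(@leq_pmul2r (q ^ m)) ?expn_gt0 ?q0// mulnC; apply: H.
  apply: (@leq_trans (\sum_(f <- s) q ^ m)); first exact: leq_sum.
  by rewrite big_const_seq count_predT iter_addn_0 mulnC.
exists (fun i => nth w0 s i).
have H i j : (i < j < 2 ^ m)%N -> far (nth w0 s i) (nth w0 s j).
  move=> /andP[ij jM]; have /allP := Hs j jM; apply.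
  rewrite -(nth_take w0 ij); apply: mem_nth; rewrite size_takel// sM; exact: ltnW.
move=> i j; rewrite -(inj_eq val_inj) neq_ltn => /orP[] ij.
  by apply: H; rewrite ij ltn_ord.
by rewrite agreeC; apply: H; rewrite ij ltn_ord.
Qed.

Lemma unif_pmf_supp (R : realType) (T : finType) (M : nat) (phi : 'I_M -> T)
  (M0 : (0 < M)%N) x : 0 < unif_pmf R phi M0 x -> exists i, phi i = x.
Proof.
rewrite /= => Qx; apply: contrapT => /forallNP H.
by move: Qx; rewrite big1 ?mulr0 ?ltxx// => i _; have /eqP/negbTE-> := H i.
Qed.

(* Ahlswede-Dueck: a word [f] is sent as a uniformly chosen codeword
   [u (j, f j)], and recognised by the union of the decoding sets of these. *)
Lemma id_code_of_code (R : realType) (T : finType) d (Y : measurableType d)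
  (W : T -> probability Y R) M (u : 'I_M -> T) (D : 'I_M -> set Y) e k m :
  (0 < k)%N -> (0 < m)%N -> (m * 4 ^ k <= M)%N ->
  (forall i, measurable (D i)) -> (forall i j, i != j -> D i `&` D j = set0) ->
  (forall i, fine (W (u i) (~` D i)) <= e) ->
  exists (Qi : 'I_(2 ^ m) -> pmf R T) (Di : 'I_(2 ^ m) -> set Y),
    [/\ forall i x, 0 < Qi i x -> exists j, u j = x,
        forall i, measurable (Di i),
        forall i, \sum_x Qi i x * fine (W x (~` Di i)) <= e &
        forall i j, j != i -> \sum_x Qi j x * fine (W x (Di i)) <= k%:R^-1 + e].
Proof.
move=> k0 m0 mM mD dD He; have [w Hw] := separated_words m k0.
set q := (4 ^ k)%N in w Hw mM.
have m0R : 0 < m%:R :> R by rewrite ltr0n.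
have cM : (#|{: 'I_m * 'I_q}| <= M)%N by rewrite card_prod !card_ord.
pose code p := widen_ord cM (enum_rank p).
have codeI : injective code by move=> p p' [] /val_inj /enum_rank_inj.
have e0 : 0 <= e.
  have M0 : (0 < M)%N by apply: leq_trans mM; rewrite muln_gt0 m0 expn_gt0.
  have i0 := Ordinal M0.
  by apply: le_trans (He i0); rewrite prob_ge0.
pose Di i := \big[setU/set0]_j D (code (j, w i j)).
have mDi i : measurable (Di i) by apply: bigsetU_measurable.
pose phi i j := u (code (j, w i j)).
have avg_le (F : 'I_m -> R) b : \sum_j F j <= m%:R * b -> m%:R^-1 * \sum_j F j <= b.
  by move=> Fb; rewrite mulrC ler_pdivrMr// [b * _]mulrC.
exists (fun i => unif_pmf R (phi i) m0), Di; split=> //.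
- by move=> i x /unif_pmf_supp[j <-]; exists (code (j, w i j)).
- move=> i; rewrite unif_pmf_avg; apply: avg_le.
  rewrite mulr_natl -[m in leRHS]card_ord -sumr_const; apply: ler_sum => j _.
  apply: le_trans (He (code (j, w i j))); apply: prob_le.
  + exact: measurableC.
  + exact: measurableC.
  + by apply: subsetC; rewrite /Di (bigD1 j)//=; exact: subsetUl.
- move=> i i' ii'; rewrite unif_pmf_avg; apply: avg_le.
  apply: (@le_trans _ _ (\sum_j ((w i j == w i' j)%:R + e))).
    apply: ler_sum => j _; case: eqVneq => [_|wij].
      by apply: (le_trans (prob_le1 _ (mDi i))); rewrite lerDl.
    rewrite add0r; apply: le_trans (He (code (j, w i' j))).
    apply: prob_le; [exact: mDi|exact: measurableC|].
    move=> y; rewrite /Di -bigcup_seq => -[j' _ Dj'] Dj.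
    suff : (D (code (j', w i j')) `&` D (code (j, w i' j))) y.
      rewrite dD//; apply: contra wij => /eqP/codeI[<- /eqP//].
    by split.
  rewrite big_split/= sumr_const card_ord mulrDr [_ * e]mulr_natl lerD2r.
  rewrite -natr_sum (_ : (\sum_j _)%N = agree (w i) (w i')); last first.
    by rewrite /agree -sum1_card [RHS]big_mkcond/=; apply: eq_bigr => j _; rewrite inE; case: eqP.
  by rewrite ler_pdivlMr ?ltr0n// -natrM ler_nat ltnW// Hw// eq_sym.
Qed.
Section limits.
Context {R : realType}.
Implicit Types (u : nat -> \bar R) (v : nat -> R).

Lemma esup_near u (a l : \bar R) : (limn_esup u <= l)%E -> (l < a)%E ->
  \forall n \near \oo, (u n < a)%E.
Proof.
move=> ul la; have /ereal_inf_lt[_ [V FV <-] Va] := le_lt_trans ul la.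
apply: filterS FV => n Vn; apply: le_lt_trans Va; apply: ereal_sup_ubound.
by exists n.
Qed.

Lemma esup_le u (l : R) :
  (forall a : R, l < a -> \forall n \near \oo, (u n <= a%:E)%E) ->
  (limn_esup u <= l%:E)%E.
Proof.
move=> H; apply/lee_addgt0Pr => e e0; rewrite -EFinD.
have Ve : \forall n \near \oo, (u n <= (l + e)%:E)%E by apply: H; rewrite ltrDl.
apply: (@le_trans _ _ (ereal_sup (u @` [set n | (u n <= (l + e)%:E)%E]))).
  by apply: ereal_inf_lbound; exists [set n | (u n <= (l + e)%:E)%E].
by apply: ge_ereal_sup => _ [n /= un <-].
Qed.

Lemma einf_near u (a l : \bar R) : (l <= limn_einf u)%E -> (a < l)%E ->
  \forall n \near \oo, (a < u n)%E.
Proof.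
rewrite /limn_einf leeNr -lteN2 => ul al.
by apply: filterS (esup_near ul al) => n; rewrite lteN2.
Qed.

Lemma einf_ge u (l : R) :
  (forall a : R, a < l -> \forall n \near \oo, (a%:E <= u n)%E) ->
  (l%:E <= limn_einf u)%E.
Proof.
move=> H; rewrite /limn_einf leeNr -EFinN; apply: esup_le => a la.
have : \forall n \near \oo, ((- a)%:E <= u n)%E by apply: H; rewrite ltrNl.
by apply: filterS => n; rewrite leeNl EFinN.
Qed.

Lemma esup_cvg0 v : (forall n, 0 <= v n) -> (limn_esup (EFin \o v) <= 0)%E ->
  v @ \oo --> (0 : R).
Proof.
move=> v0 vl; apply/cvgrPdist_lt => e e0.
have e0' : (0 < e%:E)%E by rewrite lte_fin.
apply: filterS (esup_near vl e0') => n /=.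
by rewrite lte_fin distrC subr0 ger0_norm.
Qed.

Lemma squeeze0 v v' : (\forall n \near \oo, 0 <= v n <= v' n) -> v' @ \oo --> (0 : R) ->
  v @ \oo --> (0 : R).
Proof. by move=> vv' v'0; apply: (squeeze_cvgr vv') => //; exact: cvg_cst. Qed.

Lemma cvg0D v v' : v @ \oo --> (0 : R) -> v' @ \oo --> (0 : R) ->
  (fun n => v n + v' n) @ \oo --> (0 : R).
Proof. by move=> v0 v'0; rewrite -[0](addr0 0); exact: cvgD. Qed.

Lemma cvg0Z (a : R) v : v @ \oo --> (0 : R) -> (fun n => a * v n) @ \oo --> (0 : R).
Proof. by move=> v0; rewrite -[0](mulr0 a); apply: cvgMr. Qed.

Lemma near_gt0 : \forall n \near \oo, (0 < n)%N.
Proof. by exists 1%N. Qed.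

Lemma exp_decay (g : R) : 0 < g ->
  (fun n => n.+1%:R * expR (- (g * n%:R))) @ \oo --> (0 : R).
Proof.
move=> g0; pose C := 1 + 2 / g.
apply: (@squeeze0 _ (geometric C (expR (- (g / 2))))); last first.
  apply: cvg_geometric; rewrite ger0_norm ?expR_ge0// expR_lt1.
  by rewrite oppr_lt0 divr_gt0.
apply: nearW => n; rewrite mulr_ge0 ?expR_ge0//= -expRM_natr.
have -> : - (g * n%:R) = g / 2 * n%:R *- 1 + - (g / 2) * n%:R by field.
rewrite expRD mulrA ler_wpM2r ?expR_ge0// expRN.
rewrite ler_pdivrMr ?expR_gt0//.
apply: (@le_trans _ _ (C * (1 + g / 2 * n%:R))).
  rewrite /C -subr_ge0 -natr1 (_ : _ - _ = g / 2 * n%:R + 2 / g); last first.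
    by field; rewrite gt_eqF.
  by have g0' := ltW g0; apply: addr_ge0; [apply: mulr_ge0 => //|]; exact: divr_ge0.
by rewrite ler_wpM2l ?expR_ge1Dx// /C addr_ge0// divr_ge0// ltW.
Qed.

Lemma exp_decay1 (g : R) : 0 < g -> (fun n => expR (- (g * n%:R))) @ \oo --> (0 : R).
Proof.
move=> g0; apply: squeeze0 (exp_decay g0); apply: nearW => n.
by rewrite expR_ge0 ler_peMl ?expR_ge0// ler1n.
Qed.

Lemma near_divn (C e : R) : 0 < e -> \forall n \near \oo, `|C / n%:R| < e.
Proof.
move=> e0; near=> n.
have n0 : 0 < n%:R :> R by rewrite ltr0n; near: n; exact: near_gt0.
rewrite normrM normfV [`|n%:R|]ger0_norm// ltr_pdivrMr// -ltr_pdivrMl//.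
have : (Num.truncn (e^-1 * `|C|) < n)%N by near: n; exact: nbhs_infty_gt.
by rewrite truncn_lt_nat// mulr_ge0// invr_ge0 ltW.
Unshelve. all: by end_near. Qed.

Lemma near_trunc_log_inv (e : R) : 0 < e ->
  \forall n \near \oo, (trunc_log 4 n).+1%:R^-1 <= e.
Proof.
move=> e0; have [j je] : exists j, (j.+1%:R)^-1 <= e.
  by have [j _ H] := near_infty_natSinv_lt (PosNum e0); exists j; exact/ltW/(H j)/leqnn.
exists (4 ^ j)%N => //= n jn; apply: le_trans je.
by rewrite lef_pV2 ?posrE// ler_nat ltnS; exact: trunc_log_max.
Qed.

Lemma nat_seq_of_exp (a : R) : 0 <= a -> exists M : nat -> nat, forall n,
  expR (a * n%:R) <= (M n)%:R <= 2 * expR (a * n%:R).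
Proof.
move=> a0; exists (fun n => (Num.truncn (expR (a * n%:R))).+1) => n.
rewrite (ltW (truncnS_gt _)) -natr1 mulr2n mulrDl mul1r lerD//.
  by rewrite truncn_le expR_ge0.
by rewrite -expR0 ler_expR mulr_ge0.
Qed.

Lemma ereal_between (x y : \bar R) : (x < y)%E -> exists r : R, (x < r%:E < y)%E.
Proof.
case: x y => [x| |] [y| |]//.
- by rewrite lte_fin => xy; exists ((x + y) / 2); rewrite !lte_fin !midf_lt.
- by move=> _; exists (x + 1); rewrite lte_fin ltrDl ltr01 ltry.
- by move=> _; exists (y - 1); rewrite lte_fin ltrBlDr ltrDl ltr01 ltNyr.
- by move=> _; exists 0; rewrite ltNyr ltry.
Qed.

Lemma le_of_reals (x y : \bar R) : (forall r : R, (r%:E < x)%E -> (r%:E <= y)%E) -> (x <= y)%E.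
Proof.
move=> H; rewrite leNgt; apply/negP => /ereal_between[r /andP[yr rx]].
by have := lt_le_trans yr (H r rx); rewrite ltxx.
Qed.

Lemma rateP (M : nat -> nat) n (a : R) : (0 < n)%N -> (0 < M n)%N ->
  ((a%:E <= rate R M n)%E = (expR (a * n%:R) <= (M n)%:R)) *
  ((rate R M n <= a%:E)%E = ((M n)%:R <= expR (a * n%:R))).
Proof.
move=> n0 M0; have n0R : 0 < n%:R :> R by rewrite ltr0n.
have M0R : (0 : R) < (M n)%:R by rewrite ltr0n.
split; rewrite /rate lee_fin ?ler_pdivlMr ?ler_pdivrMr//.
  by rewrite -[in RHS](@lnK R (M n)%:R) ?posrE// ler_expR.
by rewrite -[in RHS](@lnK R (M n)%:R) ?posrE// ler_expR.
Qed.

End limits.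
Section one_block.
Context (R : realType) (X : finType) d (Y : measurableType d)
  (W : forall n : nat, n.-tuple X -> probability (n.-tuple Y) R) (n : nat)
  (Q : pmf R (n.-tuple X)).

Lemma info_densE x y : info_dens W Q x y = ln (rnd Q (@W n) x y) / n%:R.
Proof. by []. Qed.

Lemma measurable_info_dens x : 0 < Q x -> measurable_fun setT (info_dens W Q x).
Proof.
move=> Qx; apply: measurable_funM; last exact: measurable_cst.
by apply: measurableT_comp; [exact: measurable_ln|exact: measurable_rnd].
Qed.

Lemma measurable_info_lt x a : 0 < Q x -> measurable [set y | info_dens W Q x y < a].
Proof.
move=> Qx; have := measurable_info_dens Qx measurableT (measurable_itv `]-oo, a[).
by rewrite setTI; congr measurable; apply/seteqP; split => y /=; rewrite in_itv/=.
Qed.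

Lemma measurable_info_gt x a : 0 < Q x -> measurable [set y | info_dens W Q x y > a].
Proof.
move=> Qx; have := measurable_info_dens Qx measurableT (measurable_itv `]a, +oo[).
by rewrite setTI; congr measurable; apply/seteqP; split => y /=; rewrite in_itv/= andbT.
Qed.

Lemma info_dens_leE x y a : (0 < n)%N -> 0 < rnd Q (@W n) x y ->
  (info_dens W Q x y <= a) = (rnd Q (@W n) x y <= expR (a * n%:R)).
Proof.
move=> n0 r0; rewrite info_densE ler_pdivrMr ?ltr0n//.
by rewrite -[in RHS](@lnK _ (rnd _ _ _ _)) ?posrE// ler_expR.
Qed.

Lemma info_dens_ltE x y a : (0 < n)%N -> 0 < rnd Q (@W n) x y ->
  (info_dens W Q x y < a) = (rnd Q (@W n) x y < expR (a * n%:R)).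
Proof.
move=> n0 r0; rewrite info_densE ltr_pdivrMr ?ltr0n//.
by rewrite -[in RHS](@lnK _ (rnd _ _ _ _)) ?posrE// ltr_expR.
Qed.

Lemma pr_rnd_gt_le a : (0 < n)%N ->
  \sum_x Q x * fine (W x [set y | expR (a * n%:R) < rnd Q (@W n) x y]) <= pr_info_gt W Q a.
Proof.
move=> n0; apply: pmf_avg_le => x Qx; apply: prob_le.
- exact: measurable_rnd_gt.
- exact: measurable_info_gt.
- by move=> y /= yt; rewrite ltNge info_dens_leE ?(lt_trans (expR_gt0 _) yt)// -ltNge.
Qed.

(* Here the null set where the density vanishes matters, because [ln 0 = 0]. *)
Lemma pr_info_gt_le a : (0 < n)%N -> pr_info_gt W Q a <=
  \sum_x Q x * fine (W x [set y | expR (a * n%:R) < rnd Q (@W n) x y]).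
Proof.
move=> n0; apply: pmf_avg_le => x Qx.
rewrite -[leRHS]addr0 -(rnd_le0_null (@W n) Qx); apply: prob_cover_le.
- exact: measurable_rnd_gt.
- exact: measurable_rnd_le.
- exact: measurable_info_gt.
- move=> y /= ya; case: (leP (rnd Q (@W n) x y) 0) => r0; [by right|left].
  by rewrite ltNge -info_dens_leE// -ltNge.
Qed.

Lemma pr_rnd_le_le a a' : (0 < n)%N -> a' < a ->
  \sum_x Q x * fine (W x [set y | rnd Q (@W n) x y <= expR (a' * n%:R)]) <= pr_info_lt W Q a.
Proof.
move=> n0 aa; apply: pmf_avg_le => x Qx.
rewrite -[leRHS]addr0 -(rnd_le0_null (@W n) Qx); apply: prob_cover_le.
- exact: measurable_info_lt.
- exact: measurable_rnd_le.
- exact: measurable_rnd_le.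
- move=> y /= ya; case: (leP (rnd Q (@W n) x y) 0) => r0; [by right|left].
  by apply: le_lt_trans aa; rewrite info_dens_leE.
Qed.

Lemma pr_info_lt_le a : (0 < n)%N -> pr_info_lt W Q a <=
  \sum_x Q x * fine (W x [set y | rnd Q (@W n) x y < expR (a * n%:R)]).
Proof.
move=> n0; apply: pmf_avg_le => x Qx; apply: prob_le.
- exact: measurable_info_lt.
- exact: measurable_rnd_lt.
- move=> y /= ya; case: (leP (rnd Q (@W n) x y) 0) => r0.
    exact: le_lt_trans (expR_gt0 _).
  by rewrite -info_dens_ltE.
Qed.

Lemma pr_rnd_leE t : \sum_x Q x * fine (W x [set y | rnd Q (@W n) x y <= t]) =
  1 - \sum_x Q x * fine (W x [set y | t < rnd Q (@W n) x y]).
Proof.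
rewrite -[1](pmf_sum1 Q) -sumrB; apply: eq_bigr => x _.
have := pmf_ge0 Q x; rewrite le_eqVlt => /predU1P[<-|Qx]; first by rewrite !mul0r subr0.
rewrite -[in RHS](mulr1 (Q x)) -mulrA mul1r -mulrBr -prob_setC; last exact: measurable_rnd_gt.
by congr (_ * fine (W x _)); apply/seteqP; split=> y /=; rewrite leNgt => /negP.
Qed.

Lemma pr_info_lt_ge0 a : 0 <= pr_info_lt W Q a.
Proof. by apply: sumr_ge0 => x _; rewrite mulr_ge0 ?pmf_ge0 ?prob_ge0. Qed.

Lemma pr_info_gt_ge0 a : 0 <= pr_info_gt W Q a.
Proof. by apply: sumr_ge0 => x _; rewrite mulr_ge0 ?pmf_ge0 ?prob_ge0. Qed.

Lemma pr_info_cover a b : b < a -> 1 <= pr_info_lt W Q a + pr_info_gt W Q b.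
Proof.
move=> ba; rewrite -big_split/= -(pmf_avg_cst Q 1).
under [leRHS]eq_bigr do rewrite -mulrDr; apply: pmf_avg_le => x Qx.
rewrite -(prob_setT (W x)); apply: prob_cover_le => //.
- exact: measurable_info_lt.
- exact: measurable_info_gt.
- move=> y _ /=; case: (ltP (info_dens W Q x y) a) => [|ay]; [by left|right].
  exact: lt_le_trans ay.
Qed.

Lemma QW_setC B : measurable B -> QW W Q (~` B) = 1 - QW W Q B.
Proof.
move=> mB; rewrite -(pmf_avg_cst Q 1) -sumrB; apply: eq_bigr => x _.
by rewrite prob_setC// mulrBr.
Qed.

End one_block.

Section capacities.
Context (R : realType) (X : finType) d (Y : measurableType d)
  (W : forall n : nat, n.-tuple X -> probability (n.-tuple Y) R)
  (c : forall n : nat, n.-tuple X -> R) (Gamma : R).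

Lemma in_S_cost_ok (n : nat) (Q : pmf R (n.-tuple X)) :
  \sum_(x | `[< cost_ok c Gamma x >]) Q x = 1 <-> (forall x, 0 < Q x -> cost_ok c Gamma x).
Proof.
split=> [Q1 x Qx|H].
  apply: contrapT => /asboolPn nx; have := pmf_sum1 Q.
  rewrite (bigID (fun x => `[< cost_ok c Gamma x >]))/= Q1 (bigD1 x)//=.
  move/eqP; rewrite -subr_eq0 addrAC subrr add0r paddr_eq0 ?(ltW Qx)//.
    by rewrite gt_eqF.
  by apply: sumr_ge0 => y _; exact: pmf_ge0.
rewrite -(pmf_sum1 Q) big_mkcond/=; apply: eq_bigr => x _.
case: asboolP => // nx; apply/eqP; rewrite eq_sym; apply: contrapT => /negP.
by rewrite -pmf_gt0_neq0 => /H.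
Qed.

Lemma I_low_le_I_up Qs : (I_low W Qs <= I_up W Qs)%E.
Proof.
apply: ge_ereal_sup => _ [a /= la <-]; apply: le_ereal_inf_tmp => _ [b /= gb <-].
rewrite lee_fin leNgt; apply/negP => ba.
have /cvgr_lt/(_ 1 ltr01) lt1 := cvg0D la gb.
have [n] := @filter_ex _ _ (@eventually_filter) _ lt1.
by rewrite ltNge pr_info_cover.
Qed.

Lemma sup_I_low_le_sup_I_up : (sup_I_low W c Gamma <= sup_I_up W c Gamma)%E.
Proof.
apply: ge_ereal_sup => _ [Qs HQ <-]; apply: le_trans (I_low_le_I_up Qs) _.
by apply: ereal_sup_ubound; exists Qs.
Qed.

Lemma Cs_mono e1 e2 : e1 <= e2 -> (Cs W c Gamma e1 <= Cs W c Gamma e2)%E.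
Proof.
move=> e12; apply: le_ereal_sup => _ [r [M [phi [psi [H1 H2 H3]]]] <-].
by exists r => //; exists M, phi, psi; split=> //; rewrite (le_trans H2)// lee_fin.
Qed.

Lemma Did_mono m1 m2 l1 l2 : m1 <= m2 -> l1 <= l2 ->
  (Did W c Gamma m1 l1 <= Did W c Gamma m2 l2)%E.
Proof.
move=> m12 l12; apply: le_ereal_sup => _ [r [N [Qi [D [H1 H2 H3 H4]]]] <-].
by exists r => //; exists N, Qi, D; split=> //;
  [rewrite (le_trans H2)// lee_fin|rewrite (le_trans H3)// lee_fin].
Qed.

Lemma Sres_anti d1 d2 : d1 <= d2 -> (Sres W c Gamma d2 <= Sres W c Gamma d1)%E.
Proof.
move=> d12; apply: ereal_inf_le_tmp => _ [r Hr <-]; exists r => // Qs HQ.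
have [M [phi [H1 H2 H3 H4]]] := Hr Qs HQ.
by exists M, phi; split=> //; rewrite (le_trans H3)// lee_fin.
Qed.

Lemma trans_err_ge0 M phi psi n : 0 <= @trans_err R X d Y W M phi psi n.
Proof. by rewrite mulr_ge0 ?invr_ge0// sumr_ge0// => i _; rewrite prob_ge0. Qed.

Lemma Cs_le_Cs0 eps : strong_converse W c Gamma -> eps < 1 ->
  (Cs W c Gamma eps <= Cs W c Gamma 0)%E.
Proof.
move=> sc e1; apply: ge_ereal_sup => _ [r [M [phi [psi [code errle rle]]]] <-].
rewrite leNgt; apply/negP => Cr.
have cvg1 := sc _ _ _ code (lt_le_trans Cr rle).
have em : eps < (eps + 1) / 2 < 1 by rewrite !midf_lt.
have /andP[em1 em2] := em.
have em1' : (eps%:E < ((eps + 1) / 2)%:E)%E by rewrite lte_fin.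
have lo := esup_near errle em1'.
have /cvgr_gt/(_ _ em2) hi := cvg1.
have [n [/= + +]] := @filter_ex _ _ (@eventually_filter) _ (filterI lo hi).
by rewrite lte_fin => /lt_trans /[apply]; rewrite ltxx.
Qed.

Lemma Cs0_le_sup_I_low : (Cs W c Gamma 0 <= sup_I_low W c Gamma)%E.
Proof.
apply: ge_ereal_sup => _ [r [M [phi [psi [code errle rle]]]] <-].
have M0 n : (0 < M n)%N by have [] := code n.
pose Qs : input_process R X := fun n => unif_pmf R (phi n) (M0 n).
have QS : in_S c Gamma Qs.
  move=> n; apply/in_S_cost_ok => x /unif_pmf_supp[i <-].
  by have [] := code n.
apply: (@le_trans _ _ (I_low W Qs)); last by apply: ereal_sup_ubound; exists Qs.
apply: le_of_reals => a; rewrite lte_fin => ar; apply: ereal_sup_ubound; exists a => //=.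
have [g0 ag] : 0 < (r - a) / 2 /\ a + (r - a) / 2 < r by split; lra.
set g := (r - a) / 2 in g0 ag.
have err0 : trans_err W phi psi n @[n --> \oo] --> (0 : R).
  by apply: esup_cvg0 => // n; exact: trans_err_ge0.
have agr : ((a + g)%:E < r%:E)%E by rewrite lte_fin.
have Mlarge := einf_near rle agr.
apply: squeeze0 (cvg0D err0 (exp_decay1 g0)).
have near0 := near_gt0.
apply: filterS2 near0 Mlarge => n n0 /ltW; rewrite (rateP _ n0 (M0 n)) => Mn.
rewrite pr_info_lt_ge0/=; apply: le_trans (pr_info_lt_le _ _ _ n0) _.
have [_ _ mpsi] := code n.
apply: le_trans (verdu_han (@W n) (phi n) (M0 n) (expR_ge0 _) mpsi) _.
rewrite lerD2l ler_pdivrMr ?ltr0n//; apply: le_trans (ler_wpM2l (expR_ge0 _) Mn).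
by rewrite -expRD ler_expR; lra.
Qed.

Lemma Cs0_ge0 Qs : in_S c Gamma Qs -> (0 <= Cs W c Gamma 0)%E.
Proof.
move=> QS; have xs n : {x : n.-tuple X | cost_ok c Gamma x}.
  apply: cid; have [x Qx _] : exists2 x, 0 < Qs n x & 0 <= 0 :> R.
    by apply: (@exists_le_avg _ _ _ (fun=> 0)); rewrite pmf_avg_cst.
  by exists x; move/in_S_cost_ok : (QS n); exact.
apply: ereal_sup_ubound; exists 0 => //.
exists (fun=> 1%N), (fun n _ => sval (xs n)), (fun n _ => ord0); split.
- move=> n; split=> // [i|i]; first exact: (svalP (xs n)).
  rewrite (_ : _ @^-1` _ = setT)//; apply/seteqP; split=> // y _ /=.
  by rewrite [RHS]ord1.
- apply: esup_le => a a0; apply: nearW => n; rewrite lee_fin; apply: le_trans (ltW a0).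
  rewrite /trans_err big_ord1 (_ : ~` _ = set0) ?measure0 ?mulr0//.
  by apply/seteqP; split=> // y /=; apply.
- by apply: einf_ge => a a0; apply: nearW => n; rewrite /rate ln1 mul0r lee_fin ltW.
Qed.

End capacities.
Section converses.
Context (R : realType) (X : finType) d (Y : measurableType d)
  (W : forall n : nat, n.-tuple X -> probability (n.-tuple Y) R)
  (c : forall n : nat, n.-tuple X -> R) (Gamma : R).

Lemma sup_I_up_le_Cs0 : strong_converse W c Gamma ->
  (sup_I_up W c Gamma <= Cs W c Gamma 0)%E.
Proof.
move=> sc; apply: ge_ereal_sup => _ [Qs QS <-].
rewrite leNgt; apply/negP => /ereal_between[a /andP[Ca aI]].
have [a' /andP[Ca' a'a]] := ereal_between Ca; rewrite lte_fin in a'a.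
have a'0 : 0 <= a' by rewrite -lee_fin (le_trans (Cs0_ge0 W QS))// ltW.
have [M HM] := nat_seq_of_exp a'0.
pose e n := \sum_x Qs n x * fine (W x [set y | rnd (Qs n) (@W n) x y <= expR (a * n%:R)])
  + (M n)%:R / expR (a * n%:R).
have M0 n : (0 < M n)%N.
  by rewrite -(ltr_nat R); have /andP[+ _] := HM n; apply: lt_le_trans; exact: expR_gt0.
have code n : {u : 'I_(M n) -> n.-tuple X & {psi : n.-tuple Y -> 'I_(M n) |
    [/\ forall i, 0 < Qs n (u i), forall i, measurable (psi @^-1` [set i]) &
     forall i, fine (W (u i) (~` (psi @^-1` [set i]))) <= e n]}}.
  have [u /cid[D [Qu mD dD De]]] :=
    cid (feinstein (M := M n) (W := @W n) (expR_gt0 (a * n%:R)) (lexx (e n))).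
  have [psi Hpsi] := cid (disjoint_decoder (M0 n) mD dD).
  exists u, psi; split=> // i; first by have [] := Hpsi i.
  apply: le_trans (De i); have [mpsi Dpsi] := Hpsi i.
  by apply: prob_le; [exact: measurableC|exact: measurableC|exact: subsetC].
pose phi n := projT1 (code n); pose psi n := sval (projT2 (code n)).
have Hcode n := svalP (projT2 (code n)).
have err1 : trans_err W phi psi n @[n --> \oo] --> (1 : R).
  apply: sc.
    move=> n; have [Qu mpsi _] := Hcode n; split=> // i.
    by have /in_S_cost_ok := QS n; apply; exact: Qu.
  apply: (lt_le_trans Ca'); apply: einf_ge => b ba'; have near0 := near_gt0.
  apply: filterS near0 => n n0; rewrite (rateP b n0 (M0 n)).
  have /andP[+ _] := HM n; apply: le_trans.
  by rewrite ler_expR ler_wpM2r// ltW.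
have aa'0 : 0 < a - a' by rewrite subr_gt0.
have gt0 : pr_info_gt W (Qs n) a @[n --> \oo] --> (0 : R).
  have lim0 : (1 - trans_err W phi psi n) @[n --> \oo] --> (0 : R).
    by rewrite -[0](subrr 1); apply: cvgB => //; exact: cvg_cst.
  apply: squeeze0 (cvg0D lim0 (cvg0Z 2 (exp_decay1 aa'0))); have near0 := near_gt0.
  apply: filterS near0 => n n0; rewrite pr_info_gt_ge0/=.
  apply: le_trans (pr_info_gt_le _ _ _ n0) _.
  have [_ _ He] := Hcode n; have /andP[_ M2] := HM n.
  have err_e : trans_err W phi psi n <= e n.
    rewrite /trans_err mulrC ler_pdivrMr ?ltr0n// mulr_natr.
    by rewrite -[M n in leRHS]card_ord -sumr_const; apply: ler_sum => i _; exact: He.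
  have Me : (M n)%:R / expR (a * n%:R) <= 2 * expR (- ((a - a') * n%:R)).
    rewrite ler_pdivrMr ?expR_gt0// -mulrA -expRD.
    by rewrite (_ : _ + _ = a' * n%:R)//; ring.
  by move: err_e; rewrite /e pr_rnd_leE; lra.
by move: aI; rewrite ltNge => /negP; apply; apply: ereal_inf_lbound; exists a.
Qed.

Lemma Did_ge0 Qs : in_S c Gamma Qs -> (0 <= Did W c Gamma 0 0)%E.
Proof.
move=> QS; apply: ereal_sup_ubound; exists 0 => //.
exists (fun=> 1%N), (fun n _ => Qs n), (fun n _ => setT); split.
- by move=> n; split.
- apply: esup_le => a a0; apply: nearW => n; rewrite lee_fin; apply: le_trans (ltW a0).
  apply: bigmax_le => // i _; rewrite /QW big1// => x _.
  by rewrite setCT measure0 mulr0.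
- apply: esup_le => a a0; apply: nearW => n; rewrite lee_fin; apply: le_trans (ltW a0).
  apply: bigmax_le => // i _; apply: bigmax_le => // j.
  by rewrite [i]ord1 [j]ord1 eqxx.
- by apply: einf_ge => a a0; apply: nearW => n; rewrite /id_rate ln1 ln0// mul0r lee_fin ltW.
Qed.

Lemma sup_I_low_le_Did : (sup_I_low W c Gamma <= Did W c Gamma 0 0)%E.
Proof.
apply: ge_ereal_sup => _ [Qs QS <-]; apply: ge_ereal_sup => _ [a /= la <-].
apply: le_of_reals => b; rewrite lte_fin => ba.
have [b0|b0] := leP b 0.
  by apply: le_trans (Did_ge0 QS); rewrite lee_fin.
apply: ereal_sup_ubound; exists b => //.
have [t /andP[bt ta]] : exists t, b < t < a by exists ((b + a) / 2); rewrite !midf_lt.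
have [m Hm] := nat_seq_of_exp (ltW b0).
have m0 n : (0 < m n)%N.
  by rewrite -(ltr_nat R); have /andP[+ _] := Hm n; apply: lt_le_trans; exact: expR_gt0.
pose k n := (trunc_log 4 n).+1.
pose M n := (m n * 4 ^ k n)%N.
pose e n := \sum_x Qs n x * fine (W x [set y | rnd (Qs n) (@W n) x y <= expR (t * n%:R)])
  + (M n)%:R / expR (t * n%:R).
have code n : {Qi : 'I_(2 ^ m n) -> pmf R (n.-tuple X) & {Di : 'I_(2 ^ m n) -> set (n.-tuple Y) |
    [/\ forall i x, 0 < Qi i x -> cost_ok c Gamma x, forall i, measurable (Di i),
        forall i, QW W (Qi i) (~` Di i) <= e n &
        forall i j, j != i -> QW W (Qi j) (Di i) <= (k n)%:R^-1 + e n]}}.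
  have [u /cid[D [Qu mD dD De]]] :=
    cid (feinstein (M := M n) (W := @W n) (expR_gt0 (t * n%:R)) (lexx (e n))).
  have [Qi /cid[Di [QiS mDi Qie Qile]]] :=
    cid (@id_code_of_code R _ _ _ (@W n) (M n) u D (e n) (k n) (m n) isT (m0 n)
      (leqnn _) mD dD De).
  exists Qi, Di; split=> // i x /QiS[j <-].
  by have /in_S_cost_ok := QS n; apply.
pose Qi n := projT1 (code n); pose Di n := sval (projT2 (code n)).
have Hcode n := svalP (projT2 (code n)).
have tb0 : 0 < t - b by rewrite subr_gt0.
have e_ge0 n : 0 <= e n.
  by rewrite addr_ge0 ?divr_ge0 ?expR_ge0// sumr_ge0// => x _; rewrite mulr_ge0 ?pmf_ge0 ?prob_ge0.
have e0 : e n @[n --> \oo] --> (0 : R).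
  apply: squeeze0 (cvg0D la (cvg0Z 8 (exp_decay tb0))); have near0 := near_gt0.
  apply: filterS near0 => n n0; rewrite e_ge0/=; apply: lerD; first exact: pr_rnd_le_le.
  have /andP[_ m2] := Hm n.
  have k4 : (4 ^ k n)%:R <= 4 * n.+1%:R :> R.
    rewrite -natrM ler_nat expnS leq_mul2l/=.
    by apply: (leq_trans (trunc_logP _ _)).
  rewrite ler_pdivrMr ?expR_gt0// natrM.
  apply: (le_trans (ler_pM _ _ m2 k4)) => //.
  rewrite -mulrA -mulrA -mulrA -expRD.
  have -> : - ((t - b) * n%:R) + t * n%:R = b * n%:R by ring.
  by rewrite le_eqVlt; apply/orP; left; apply/eqP; ring.
exists (fun n => 2 ^ m n)%N, Qi, Di; split.
- move=> n; have [QiS mDi _ _] := Hcode n; split=> //; first by rewrite expn_gt0.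
  by move=> i; apply/in_S_cost_ok => x; exact: QiS.
- apply: esup_le => a' a'0; apply: filterS (cvgr_lt _ e0 _ a'0) => n /ltW ea.
  rewrite lee_fin; apply: le_trans ea; apply: bigmax_le => // i _.
  by have [_ _ + _] := Hcode n; apply.
- apply: esup_le => a' a'0; have a'2 : 0 < a' / 2 by rewrite divr_gt0.
  apply: filterS2 (cvgr_lt _ e0 _ a'2) (near_trunc_log_inv a'2) => n /ltW ea ka.
  rewrite lee_fin [leRHS]splitr; apply: bigmax_le => [|i _].
    by rewrite addr_ge0// ltW.
  apply: bigmax_le => [|j ji]; first by rewrite addr_ge0// ltW.
  have [_ _ _ /(_ i j ji)/le_trans] := Hcode n; apply.
  exact: lerD.
- apply: einf_ge => b' b'b; have bb : 0 < b - b' by rewrite subr_gt0.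
  have near0 := near_gt0.
  apply: filterS2 near0 (near_divn (ln (ln 2)) bb) => n n0.
  rewrite ltr_norml => /andP[+ _] => H.
  have ln2 : 0 < ln 2 :> R by rewrite ln_gt0// ltr1n.
  have m0R : 0 < (m n)%:R :> R by rewrite ltr0n.
  rewrite /id_rate; have -> : ln (ln (2 ^ m n)%:R) = ln (m n)%:R + ln (ln 2) :> R.
    rewrite natrX lnXn// -[ln 2 *+ _]mulr_natl.
    by rewrite lnM ?posrE.
  rewrite lee_fin mulrDl; have /andP[m1 _] := Hm n.
  have : b <= ln (m n)%:R / n%:R.
    by rewrite ler_pdivlMr ?ltr0n// -ler_expR lnK// posrE.
  by move: H; lra.
Qed.

Lemma resolv_achievable_gt_sup_I_up b : 0 < b -> (sup_I_up W c Gamma < b%:E)%E ->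
  resolv_achievable W c Gamma 0 b.
Proof.
move=> b0 Ib Qs QS.
have IQ : (I_up W Qs <= sup_I_up W c Gamma)%E by apply: ereal_sup_ubound; exists Qs.
have [_ [a /= ga <-]] := ereal_inf_lt (le_lt_trans IQ Ib); rewrite lte_fin => ab.
have [M HM] := nat_seq_of_exp (ltW b0).
have M0 n : (0 < M n)%N.
  by rewrite -(ltr_nat R); have /andP[+ _] := HM n; apply: lt_le_trans; exact: expR_gt0.
have [g [g0 gE]] : exists g, 0 < g /\ b = a + 2 * g.
  by exists ((b - a) / 2); split; [rewrite divr_gt0// subr_gt0|field].
have code n := cid (soft_covering (Qs n) (@W n) (expR_ge0 (a * n%:R)) (M0 n)
  (expR_gt0 (- (g * n%:R)))).
pose phi n := sval (code n).
exists M, phi; split=> //.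
- move=> n i; have /in_S_cost_ok := QS n; apply.
  by have [+ _] := svalP (code n); apply.
- have lim0 := cvg0D (cvg0Z 2 (exp_decay1 g0)) (cvg0Z 4 ga).
  apply: esup_le => e e0; have near0 := near_gt0.
  apply: filterS2 near0 (cvgr_lt _ lim0 _ e0) => n n0 /ltW lime.
  rewrite /var_dist; set S := ereal_sup _.
  suff : (S <= (e / 2)%:E)%E.
    rewrite -(@lee_pmul2l _ 2%:E)// ?lte_fin// => /le_trans; apply.
    by rewrite -EFinM lee_fin; lra.
  apply: ge_ereal_sup => _ [B mB <-]; rewrite lee_fin.
  have [_ /(_ B mB)] := svalP (code n); rewrite outmE//; move/le_trans; apply.
  have tail_le := pr_rnd_gt_le W (Qs n) a n0.
  have Mt : expR (a * n%:R) / (2 * expR (- (g * n%:R)) * (M n)%:R) <=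
      expR (- (g * n%:R)) / 2.
    have /andP[M1 _] := HM n.
    rewrite ler_pdivrMr; last by rewrite !mulr_gt0 ?expR_gt0 ?ltr0n.
    have -> : expR (- (g * n%:R)) / 2 * (2 * expR (- (g * n%:R)) * (M n)%:R) =
      expR (- (g * n%:R)) * expR (- (g * n%:R)) * (M n)%:R by field.
    apply: le_trans (ler_wpM2l _ M1); last by rewrite mulr_ge0 ?expR_ge0.
    by rewrite -!expRD ler_expR gE; lra.
  by lra.
- apply: esup_le => b' bb'; have b'b : 0 < b' - b by rewrite subr_gt0.
  have near0 := near_gt0.
  apply: filterS2 near0 (near_divn (ln 2) b'b) => n n0.
  rewrite ltr_norml => /andP[_ H]; rewrite (rateP b' n0 (M0 n)).
  have /andP[_] := HM n; move=> /le_trans; apply.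
  have p2 : (2 : R) \is Num.pos by rewrite posrE.
  rewrite -[X in X * _](lnK p2) -expRD ler_expR.
  by move: H; rewrite ltr_pdivrMr ?ltr0n//; lra.
Qed.

Lemma Sres0_le_sup_I_up :
  (Sres W c Gamma 0 <= sup_I_up W c Gamma)%E.
Proof.
have [[Qs QS]|noQ] := pselect (exists Qs, in_S c Gamma Qs); last first.
  apply: (@le_trans _ _ -oo%E); last exact: leNye.
  apply: le_of_reals => r; rewrite ltNge => /negP[]; apply: ereal_inf_lbound.
  by exists r => // Qs QS; case: noQ; exists Qs.
have I0 : (0 <= sup_I_up W c Gamma)%E.
  apply: le_trans (sup_I_low_le_sup_I_up W c Gamma); apply: le_trans (Cs0_le_sup_I_low W c Gamma).
  exact: Cs0_ge0 QS.
apply: le_of_reals => r rS; rewrite leNgt; apply/negP => Ir.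
have r0 : 0 < r by rewrite -lte_fin (le_lt_trans I0).
have := resolv_achievable_gt_sup_I_up r0 Ir.
by move: rS; rewrite ltNge => /negP + Hr; apply; apply: ereal_inf_lbound; exists r.
Qed.

End converses.
Section profiles.
Context (R : realType) (T : finType) (K : nat).
Implicit Type g : {ffun 'I_K -> option T}.

Definition profile_sum g (F : T -> R) : R := \sum_j oapp F 0 (g j).

Definition profile_avg g (F : T -> R) : R :=
  (profile_sum g (fun=> 1))^-1 * profile_sum g F.

Lemma profile_of_code M (phi : 'I_M -> T) : (M <= K)%N -> exists g, forall F : T -> R,
  profile_avg g F = M%:R^-1 * \sum_i F (phi i).
Proof.
move=> MK; pose g := [ffun j : 'I_K => omap phi (insub (val j))].
suff gE F : profile_sum g F = \sum_i F (phi i).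
  by exists g => F; rewrite /profile_avg !gE sumr_const card_ord.
pose G (j : nat) := oapp F 0 (omap phi (insub j)).
rewrite /profile_sum; under eq_bigr do rewrite ffunE -/(G _).
rewrite [RHS](_ : _ = \sum_(i < M) G i); last first.
  by apply: eq_bigr => i _; rewrite /G valK.
rewrite (big_ord_widen _ _ MK) [RHS]big_mkcond/=; apply: eq_bigr => j _.
by case: ifPn => // jM; rewrite /G insubN.
Qed.

End profiles.

Section counting.
Context (R : realType) (X : finType) d (Y : measurableType d)
  (W : forall n : nat, n.-tuple X -> probability (n.-tuple Y) R)
  (c : forall n : nat, n.-tuple X -> R) (Gamma : R).

Definition approximable (e : R) n (K : nat) (Q : pmf R (n.-tuple X)) :=
  exists g : {ffun 'I_K -> option (n.-tuple X)}, forall B, measurable B ->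
    `|QW W Q B - profile_avg g (fun x => fine (W x B))| <= e / 2.

Lemma var_dist_approximable e n (K M : nat) (Q : pmf R (n.-tuple X))
  (phi : 'I_M -> n.-tuple X) : (M <= K)%N -> (var_dist W Q phi <= e%:E)%E ->
  approximable e K Q.
Proof.
move=> MK; rewrite /var_dist; set S := ereal_sup _ => Se.
have {}Se : (S <= (e / 2)%:E)%E.
  rewrite -(@lee_pmul2l _ 2%:E)// ?lte_fin//; apply: (le_trans Se).
  by rewrite -EFinM lee_fin; lra.
have [g gE] := profile_of_code R phi MK; exists g => B mB; rewrite gE -lee_fin.
by apply: le_trans Se; apply: ereal_sup_ubound; exists B.
Qed.

(* Two inputs with the same profile cannot be identified, so approximability
   bounds the number of messages by the number of profiles. *)
Lemma approximable_count e mu la n K N (Qi : 'I_N -> pmf R (n.-tuple X))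
  (D : 'I_N -> set (n.-tuple Y)) : e + mu + la < 1 ->
  (forall i, measurable (D i)) ->
  (forall i, QW W (Qi i) (~` D i) <= mu) ->
  (forall i j, j != i -> QW W (Qi j) (D i) <= la) ->
  (forall i, approximable e K (Qi i)) -> (N <= ((#|X| ^ n).+1) ^ K)%N.
Proof.
move=> small mD Dmu Dla /choice[g Hg].
have gI : injective g.
  move=> i j gij; apply/eqP; rewrite -[_ == _]negbK eq_sym; apply/negP => ji.
  have := Hg i (D i) (mD i); have := Hg j (D i) (mD i).
  rewrite -gij !ler_norml => /andP[H1 H2] /andP[H3 H4].
  have := Dmu i; rewrite QW_setC// => H5; have := Dla i j ji => H6.
  lra.
by have := leq_card g gI; rewrite card_ffun card_option card_tuple !card_ord.
Qed.

Lemma Did_le_Sres mu la de : de + mu + la < 1 ->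
  (Did W c Gamma mu la <= Sres W c Gamma de)%E.
Proof.
move=> small; apply: ge_ereal_sup => _ [r [N [Qi [D [code muN laN rN]]]] <-].
apply: le_ereal_inf_tmp => _ [s Hs <-]; rewrite lee_fin leNgt; apply/negP => sr.
pose eta := (1 - de - mu - la) / 4.
have eta0 : 0 < eta by rewrite divr_gt0//; lra.
have N0 n : (0 < N n)%N by have [] := code n.
have QiS n i : \sum_(x | `[< cost_ok c Gamma x >]) Qi n i x = 1 by have [] := code n.
have s0 : 0 <= s.
  have [|M [phi [M0 _ _ Ms]]] := Hs (fun n => Qi n (Ordinal (N0 n))); first by move=> n.
  rewrite leNgt; apply/negP => s0.
  have ss2 : (s%:E < 0)%E by rewrite lte_fin.
  have [n] := @filter_ex _ _ (@eventually_filter) _ (esup_near Ms ss2).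
  rewrite /rate lte_fin ltNge divr_ge0// ln_ge0//; have := M0 n.
  by rewrite ler1n.
pose t := s + (r - s) / 3; pose t' := s + (r - s) * 2 / 3.
have [st tt' t'r] : [/\ s < t, t < t' & t' < r] by rewrite /t /t'; split; lra.
have t0 : 0 < t by exact: le_lt_trans st.
have [K HK] := nat_seq_of_exp (ltW t0).
have lnlnN : \forall n \near \oo, expR (expR (t' * n%:R)) < (N n)%:R.
  have t'r' : (t'%:E < r%:E)%E by rewrite lte_fin.
  have near0 := near_gt0; apply: filterS2 near0 (einf_near rN t'r') => n n0.
  have t'n0 : 0 < t' * n%:R by rewrite mulr_gt0 ?ltr0n// (lt_trans t0).
  rewrite /id_rate lte_fin ltr_pdivlMr ?ltr0n// => H.
  have lnN0 : 0 < ln (N n)%:R :> R.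
    rewrite ltNge; apply/negP => /ln0 lnN; move: H; rewrite lnN ltNge => /negP; apply.
    exact: ltW.
  by rewrite -(@lnK R (N n)%:R) ?posrE ?ltr0n// ltr_expR -(@lnK R (ln _)) ?posrE// ltr_expR.
(* Resolvability is applied to a single process, whose n-th input is chosen to
   be not approximable if any [Qi n i] is not. *)
have bad n : exists i, approximable (de + eta) (K n) (Qi n i) ->
    forall j, approximable (de + eta) (K n) (Qi n j).
  have [[i Hi]|H] := pselect (exists i, ~ approximable (de + eta) (K n) (Qi n i)).
    by exists i => /Hi.
  exists (Ordinal (N0 n)) => _ j; apply: contrapT => Hj; apply: H; by exists j.
have [|M [phi [M0 _ Mde Ms]]] := Hs (fun n => Qi n (sval (cid (bad n)))); first by move=> n.
have st' : (s%:E < t%:E)%E by rewrite lte_fin.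
have deta : (de%:E < (de + eta)%:E)%E by rewrite lte_fin ltrDl.
have allapp : \forall n \near \oo, forall j, approximable (de + eta) (K n) (Qi n j).
  have near0 := near_gt0.
  apply: filterS3 near0 (esup_near Ms st') (esup_near Mde deta) => n n0 /ltW Mt /ltW.
  move=> app; apply: (svalP (cid (bad n))); apply: var_dist_approximable app.
  move: Mt; rewrite (rateP t n0 (M0 n)) => Mt; have /andP[K1 _] := HK n.
  by rewrite -(ler_nat R) (le_trans Mt).
have mueta : (mu%:E < (mu + eta)%:E)%E by rewrite lte_fin ltrDl.
have laeta : (la%:E < (la + eta)%:E)%E by rewrite lte_fin ltrDl.
have Nle : \forall n \near \oo, (N n <= ((#|X| ^ n).+1) ^ K n)%N.
  apply: filterS3 allapp (esup_near muN mueta) (esup_near laN laeta) => n app.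
  rewrite !lte_fin => /ltW mun /ltW lan; have [_ _ mD] := code n.
  apply: (@approximable_count (de + eta) (mu + eta) (la + eta) n (K n) (N n) (Qi n) (D n)) => //.
  - by rewrite /eta; lra.
  - move=> i; apply: le_trans mun; rewrite /id_mu.
    by apply: (le_bigmax _ (fun i => QW W (Qi n i) (~` D n i))).
  - move=> i j ji; apply: le_trans lan; rewrite /id_lambda.
    apply: (@le_trans _ _ (\big[Num.max/0]_(j < N n | j != i) QW W (Qi n j) (D n i))).
      exact: (le_bigmax_cond _ (P := fun j => j != i) (fun j => QW W (Qi n j) (D n i)) ji).
    exact: (le_bigmax _ (fun i => \big[Num.max/0]_(j < N n | j != i) QW W (Qi n j) (D n i))).
pose L : R := ln (#|X|.+1)%:R.
have g0 : 0 < t' - t by rewrite subr_gt0.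
have lim0 := cvg0Z (2 * L) (exp_decay g0).
near \oo => n.
have n0 : (0 < n)%N by near: n; exact: near_gt0.
have N1 : expR (expR (t' * n%:R)) < (N n)%:R by near: n.
have N2 : (N n <= ((#|X| ^ n).+1) ^ K n)%N by near: n.
have lt1 : 2 * L * (n.+1%:R * expR (- ((t' - t) * n%:R))) < 1.
  by near: n; exact: (cvgr_lt _ lim0 _ ltr01).
have L0 : 0 <= L by rewrite ln_ge0// ler1n.
have NL : (N n)%:R <= expR (L * n%:R * (K n)%:R) :> R.
  rewrite -mulrA -natrM expRM_natr /L lnK ?posrE ?ltr0n// -natrX ler_nat.
  apply: (leq_trans N2); rewrite expnM.
  case: (K n) => // k; rewrite leq_exp2r//; by rewrite ltn_exp2r.
have := lt_le_trans N1 NL; rewrite ltr_expR => expt'.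
have /andP[_ K2] := HK n.
have : expR (t' * n%:R) < 2 * L * n.+1%:R * expR (t * n%:R).
  apply: lt_le_trans expt' _.
  rewrite (_ : _ * expR _ = L * n.+1%:R * (2 * expR (t * n%:R))); last by ring.
  by apply: ler_pM; rewrite ?mulr_ge0// ler_wpM2l// ler_nat.
have e0 := expR_gt0 (- (t' * n%:R)).
rewrite -(ltr_pM2r e0) -expRD subrr expR0 -[X in _ < X]mulrA -expRD.
rewrite (_ : t * n%:R - t' * n%:R = - ((t' - t) * n%:R)); last by ring.
by rewrite -(mulrA (2 * L)) => /(lt_trans lt1); rewrite ltxx.
Unshelve. all: by end_near. Qed.

End counting.
Theorem theorem5p2 (R : realType) (X : finType) (d : measure_display)
  (Y : measurableType d)
  (W : forall n : nat, n.-tuple X -> probability (n.-tuple Y) R)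
  (c : forall n : nat, n.-tuple X -> R) (Gamma : R) :
  strong_converse W c Gamma ->
  forall eps delta mu lambda : R,
    0 <= eps -> 0 <= delta -> 0 <= mu -> 0 <= lambda ->
    eps < 1 -> mu + lambda < 1 -> delta < 1 ->
    [/\ sup_I_low W c Gamma = Cs W c Gamma eps,
        Cs W c Gamma eps = Did W c Gamma mu lambda,
        Did W c Gamma mu lambda = Sres W c Gamma delta &
        Sres W c Gamma delta = sup_I_up W c Gamma].
Proof.
move=> sc eps de mu la eps0 de0 mu0 la0 eps1 mula1 de1.
have AB := sup_I_low_le_sup_I_up W c Gamma.
have BC := sup_I_up_le_Cs0 sc.
have CA := Cs0_le_sup_I_low W c Gamma.
have AD := sup_I_low_le_Did W c Gamma.
have SB := Sres0_le_sup_I_up W c Gamma.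
have BA : sup_I_up W c Gamma = sup_I_low W c Gamma.
  by apply/eqP; rewrite eq_le AB (le_trans BC CA).
have CE : Cs W c Gamma eps = sup_I_low W c Gamma.
  apply/eqP; rewrite eq_le (le_trans (Cs_le_Cs0 sc eps1) CA)/=.
  by rewrite -BA (le_trans BC)// Cs_mono.
have DE : Did W c Gamma mu la = sup_I_low W c Gamma.
  apply/eqP; rewrite eq_le (le_trans AD (Did_mono _ _ _ mu0 la0)) andbT.
  by rewrite -BA (le_trans _ SB)// Did_le_Sres// add0r.
have SE : Sres W c Gamma de = sup_I_low W c Gamma.
  apply/eqP; rewrite eq_le -[X in (_ <= X)%E]BA (le_trans (Sres_anti _ _ _ de0) SB)/=.
  by rewrite (le_trans AD)// Did_le_Sres// !addr0.
by rewrite CE DE SE BA.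
Qed.
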